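(* For every integer $d\ge2$, let $\mathcal L^{\mathbb R}$ be the set of all real channels on $\mathcal B(\mathbb C^d)$, i.e. the quantum channels whose Choi matrix has only real entries in the fixed computational basis. Then the exact one-copy programming overhead of $\mathcal L^{\mathbb R}$ is $$\nu_1(\mathcal L^{\mathbb R})=\frac{2d^4-d^2-2d+4}{3d^2}.$$
   Context: For a quantum channel (completely positive trace-preserving map) $\mathcal E$ on $\mathcal B(\mathbb C^d)$, the Choi operator is $J_{\mathcal E}=\sum_{i,j}|i\rangle\langle j|\otimes\mathcal E(|i\rangle\langle j|)$ and the program state is $\pi_{\mathcal E}=J_{\mathcal E}/d$ on $\mathbb C^d\otimes\mathbb C^d$. HPTP means linear, Hermiticity preserving and trace preserving. The diamond norm is $\|\mathcal P\|_\diamond=\sup_R\sup_{\|X\|_1\le1}\|(\mathrm{id}_R\otimes\mathcal P)(X)\|_1$ over finite-dimensional references $R$. For a nonempty set $\mathcal S$ of channels on $\mathcal B(\mathbb C^d)$, the exact one-copy programming overhead is $\nu_1(\mathcal S)=\min\|\mathcal P\|_\diamond$ over all HPTP maps $\mathcal P:\mathcal B(\mathbb C^d\otimes(\mathbb C^d\otimes\mathbb C^d))\to\mathcal B(\mathbb C^d)$ (independent of the target) such that $\mathcal P(\rho\otimes\pi_{\mathcal E})=\mathcal E(\rho)$ for all states $\rho$ on $\mathbb C^d$ and all $\mathcal E\in\mathcal S$. *)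

(* Defs.v *)
From HB Require Import structures.
From mathcomp Require Import all_boot all_order all_algebra spectral.
From mathcomp Require Import complex mxtens.
From mathcomp Require Import all_classical all_reals all_analysis.

Set Implicit Arguments.
Unset Strict Implicit.
Unset Printing Implicit Defensive.

Import Order.TTheory GRing.Theory Num.Theory.

Local Open Scope classical_set_scope.
Local Open Scope ring_scope.
Local Open Scope complex_scope.
Local Open Scope sesquilinear_scope.

(* C^m (x) C^n is C^(m * n), with basis vector |i>|j> at position
   [mxtens_index (i, j)]; this is the ordering used by the Kronecker product
   [A *t B] of mxtens.  Linear maps B(C^n) -> B(C^m) are
   [{linear 'M[R[i]]_n -> 'M[R[i]]_m}]. *)

Section Programming.
Variable R : realType.
Local Notation C := R[i].

Definition psdmx n (A : 'M[C]_n) : Prop :=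
  A \is hermsymmx /\ forall u : 'cV[C]_n, 0 <= (u ^t* *m A *m u) 0 0.

Definition is_state n (rho : 'M[C]_n) : Prop := psdmx rho /\ \tr rho = 1.

(* Tr sqrt(X^* X): [spectral_diag] lists, with multiplicity, the eigenvalues of
   the Hermitian matrix X^* X, which are real and nonnegative. *)
Definition trace_norm n (X : 'M[C]_n) : R :=
  \sum_(i < n) Num.sqrt (complex.Re (spectral_diag (X ^t* *m X) 0 i)).

(* The block <i| X |j> of X acting on C^r (x) C^n. *)
Definition ref_block r n (X : 'M[C]_(r * n)) (i j : 'I_r) : 'M[C]_n :=
  \matrix_(a, b) X (mxtens_index (i, a)) (mxtens_index (j, b)).

(* id_R (x) P for a reference R of dimension r. *)
Definition id_tens r n m (P : {linear 'M[C]_n -> 'M[C]_m})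
    (X : 'M[C]_(r * n)) : 'M[C]_(r * m) :=
  \sum_(i < r) \sum_(j < r) (delta_mx i j : 'M[C]_r) *t P (ref_block X i j).

Definition diamond_norm n m (P : {linear 'M[C]_n -> 'M[C]_m}) : \bar R :=
  ereal_sup [set y | exists (r : nat) (X : 'M[C]_(r * n)),
    trace_norm X <= 1 /\ y = (trace_norm (id_tens P X))%:E].

Definition completely_positive n m (P : {linear 'M[C]_n -> 'M[C]_m}) : Prop :=
  forall (r : nat) (X : 'M[C]_(r * n)), psdmx X -> psdmx (id_tens P X).

Definition trace_preserving n m (P : {linear 'M[C]_n -> 'M[C]_m}) : Prop :=
  forall X : 'M[C]_n, \tr (P X) = \tr X.

Definition hermiticity_preserving n m (P : {linear 'M[C]_n -> 'M[C]_m}) :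
    Prop :=
  forall X : 'M[C]_n, X \is hermsymmx -> P X \is hermsymmx.

Definition hptp n m (P : {linear 'M[C]_n -> 'M[C]_m}) : Prop :=
  hermiticity_preserving P /\ trace_preserving P.

Definition channel n m (E : {linear 'M[C]_n -> 'M[C]_m}) : Prop :=
  completely_positive E /\ trace_preserving E.

Definition choi n m (E : {linear 'M[C]_n -> 'M[C]_m}) : 'M[C]_(n * m) :=
  \sum_(i < n) \sum_(j < n) (delta_mx i j : 'M[C]_n) *t E (delta_mx i j).

Definition program_state d (E : {linear 'M[C]_d -> 'M[C]_d}) :
    'M[C]_(d * d) := d%:R^-1 *: choi E.

Definition real_channels d : set {linear 'M[C]_d -> 'M[C]_d} :=
  [set E | channel E /\ choi E \is a realmx].

Definition exact_programming d (S : set {linear 'M[C]_d -> 'M[C]_d}) :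
    set {linear 'M[C]_(d * (d * d)) -> 'M[C]_d} :=
  [set P | hptp P /\
    forall (rho : 'M[C]_d) (E : {linear 'M[C]_d -> 'M[C]_d}),
      is_state rho -> S E -> P (rho *t program_state E) = E rho].

Definition programming_costs d (S : set {linear 'M[C]_d -> 'M[C]_d}) :
    set (\bar R) :=
  [set diamond_norm P | P in exact_programming S].

(* The overhead is a minimum: a statement on its value has to assert in addition
   that this infimum belongs to [programming_costs S]. *)
Definition overhead1 d (S : set {linear 'M[C]_d -> 'M[C]_d}) : \bar R :=
  ereal_inf (programming_costs S).

End Programming.

Arguments real_channels R d : clear implicits.

(* Main.v *)
Require Import Defs.
From HB Require Import structures.
From mathcomp Require Import all_boot all_order all_algebra spectral.
From mathcomp Require Import complex mxtens.
From mathcomp Require Import all_classical all_reals all_analysis.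
From mathcomp Require Import ring lra.

(** A is the input, BC the program register and D the output. Real channels are
    covariant under orthogonal rotations on both sides, so an optimal [P] may be
    taken with a Choi operator [\sum_(x, y) c x y P_x (x) P_y], where [P_x] acts
    on AB and [P_y] on CD and each runs over the three projectors commuting with
    all O (x) O. Exactness fixes six of the nine coefficients, and the diamond
    norm is the largest of three weighted l1 norms of the rows of [c], so the
    upper bound is the solution of a small linear program.

    The dual solution collapses to a short certificate. Let Omega be the
    unnormalised maximally entangled projector, F the swap, and
    [q (M, N) = \tr (J_P (M (x) N))]. Every exact [P] satisfies
    [q (F, F) + q (Omega, Omega) = d^5 - d^2 + 2 d] and [q (Omega, 1) = d^2],
    because the first functional only sees symmetric operators on BC, which up
    to a part controlled by trace preservation are combinations of programs.
    On the other hand [q (F, F)] and [q (Omega, 2 Omega - d)] are at most [d^3]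
    times the diamond norm: they test [P] on F_AB (x) Omega_C'C and
    Omega_AB (x) Omega_C'C, of trace norms [d^3] and [d^2], against the unitaries
    F and (2/d) Omega - 1. *)

Set Implicit Arguments.
Unset Strict Implicit.
Unset Printing Implicit Defensive.

Import Order.TTheory GRing.Theory Num.Theory.

Local Open Scope ring_scope.
Local Open Scope sesquilinear_scope.

(** * The trace norm *)

Section TraceNorm.
Variable C : numClosedFieldType.

Lemma adjmxM m n p (A : 'M[C]_(m, n)) (B : 'M[C]_(n, p)) :
  (A *m B) ^t* = B ^t* *m A ^t*.
Proof. by rewrite trmx_mul map_mxM. Qed.

Lemma adjmxD m n (A B : 'M[C]_(m, n)) : (A + B) ^t* = A ^t* + B ^t*.
Proof. by rewrite linearD /= map_mxD. Qed.

Lemma adjmxB m n (A B : 'M[C]_(m, n)) : (A - B) ^t* = A ^t* - B ^t*.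
Proof. by rewrite linearB /= map_mxB. Qed.

Lemma adjmxZ m n a (A : 'M[C]_(m, n)) : (a *: A) ^t* = a^* *: A ^t*.
Proof. by rewrite linearZ /= map_mxZ. Qed.

Lemma adj_scalar n (a : C) : (a%:M : 'M[C]_n) ^t* = (a^*)%:M.
Proof. by rewrite tr_scalar_mx map_scalar_mx. Qed.

(** The squared Hilbert-Schmidt norm, kept squared so that no square root enters the estimates. *)
Definition sqn m n (A : 'M[C]_(m, n)) : C := \tr (A ^t* *m A).

Lemma mxtrace_adjM m n (A B : 'M[C]_(m, n)) :
  \tr (A ^t* *m B) = \sum_j \sum_i (A i j)^* * B i j.
Proof.
by apply: eq_bigr => j _; rewrite mxE; apply: eq_bigr => i _; rewrite !mxE.
Qed.

Lemma sqnE m n (A : 'M[C]_(m, n)) : sqn A = \sum_j \sum_i `|A i j| ^+ 2.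
Proof.
rewrite /sqn mxtrace_adjM; apply: eq_bigr => j _; apply: eq_bigr => i _.
by rewrite normCK mulrC.
Qed.

Lemma sqn_ge0 m n (A : 'M[C]_(m, n)) : 0 <= sqn A.
Proof.
by rewrite sqnE; do 2!apply: sumr_ge0 => ? _; rewrite exprn_ge0.
Qed.

Lemma sqn0_eq0 m n (A : 'M[C]_(m, n)) : sqn A = 0 -> A = 0.
Proof.
rewrite sqnE => /eqP; rewrite psumr_eq0; last first.
  by move=> j _; apply: sumr_ge0 => ? _; rewrite exprn_ge0.
move=> /allP A0; apply/matrixP => i j; rewrite !mxE.
have := A0 j (mem_index_enum _); rewrite psumr_eq0; last first.
  by move=> ? _; rewrite exprn_ge0.
by move=> /allP /(_ i (mem_index_enum _)); rewrite expf_eq0 normr_eq0 => /eqP.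
Qed.

(** Cauchy-Schwarz in its arithmetic-mean form, entry by entry. Nothing is lost later, since the
    factorisations it is applied to have factors of equal norm. *)
Lemma normr_trace_adjM m n (A B : 'M[C]_(m, n)) :
  `|\tr (A ^t* *m B)| <= (sqn A + sqn B) / 2.
Proof.
rewrite mxtrace_adjM !sqnE -big_split mulr_suml.
apply: le_trans (ler_norm_sum _ _ _) _; apply: ler_sum => j _.
rewrite -big_split mulr_suml; apply: le_trans (ler_norm_sum _ _ _) _.
apply: ler_sum => i _; rewrite normrM norm_conjC /=.
rewrite ler_pdivlMr ?ltr0n // -subr_ge0.
have -> : `|A i j| ^+ 2 + `|B i j| ^+ 2 - `|A i j| * `|B i j| * 2 =
   (`|A i j| - `|B i j|) ^+ 2 by ring.
by rewrite -realEsqr rpredB // ger0_real.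
Qed.

(** Operator norm at most one, tested on matrices rather than vectors so that it applies directly to
    the factors of [trnorm_factor]. *)
Definition contractive n (W : 'M[C]_n) :=
  forall p (Z : 'M[C]_(n, p)), sqn (W *m Z) <= sqn Z.

Lemma unitary_contractive n (W : 'M[C]_n) : W ^t* *m W = 1%:M -> contractive W.
Proof. by move=> WW p Z; rewrite /sqn adjmxM mulmxA -(mulmxA _ _ W) WW mulmx1. Qed.

Lemma normr_trace_contractive n p (W : 'M[C]_n) (Y Z : 'M[C]_(n, p)) :
  contractive W -> `|\tr (W ^t* *m (Y *m Z ^t*))| <= (sqn Y + sqn Z) / 2.
Proof.
move=> Wc; rewrite mulmxA mxtrace_mulC mulmxA -adjmxM.
apply: le_trans (normr_trace_adjM _ _) _.
by rewrite ler_pM2r ?invr_gt0 ?ltr0n // addrC lerD2l.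
Qed.

(** The trace norm with values in [C], where the matrix algebra takes place; [trace_normE]
    identifies it with [trace_norm]. *)
Definition trnorm n (X : 'M[C]_n) : C :=
  \sum_i sqrtC (spectral_diag (X ^t* *m X) 0 i).

Lemma herm_gram m n (X : 'M[C]_(m, n)) : X ^t* *m X \is hermsymmx.
Proof.
by apply/is_hermitianmxP; rewrite expr0 scale1r adjmxM trmxCK.
Qed.

Lemma herm_spectral n (A : 'M[C]_n) : A \is hermsymmx ->
  exists V : 'M[C]_n, [/\ V *m V ^t* = 1%:M, V ^t* *m V = 1%:M &
    A = V ^t* *m diag_mx (spectral_diag A) *m V].
Proof.
move=> Ah; exists (spectralmx A); have Vu := spectral_unitarymx A.
have /unitarymxP VV := Vu; split=> //; first exact: mulmx1C.
have /hermitian_normalmx /orthomx_spectralP := Ah.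
by rewrite invmx_unitary.
Qed.

Lemma adj_diag_real n (s : 'rV[C]_n) :
  (forall i, 0 <= s 0 i) -> (diag_mx s) ^t* = diag_mx s.
Proof.
move=> s0; rewrite tr_diag_mx map_diag_mx; congr diag_mx.
by apply/rowP => i; rewrite mxE; apply: geC0_conj.
Qed.

Lemma herm_shift n (A : 'M[C]_n) : A \is hermsymmx ->
  exists2 c : C, 0 < c & exists Y : 'M[C]_n, c%:M + A = Y *m Y ^t*.
Proof.
move=> Ah; have [V [VV' V'V AE]] := herm_spectral Ah.
have /mxOverP Dr := hermitian_spectral_diag_real Ah.
move: Dr AE; set D := spectral_diag A => Dr AE.
(* The sum dominates every negative eigenvalue; the extra 1 keeps [c] strictly positive even for
   [A = 0]. *)
pose c : C := 1 + \sum_i `|D 0 i|.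
have cge i : 0 <= c + D 0 i.
  rewrite /c (bigD1 i) //= -addrA addr_ge0 ?ler01 //.
  rewrite addrAC addr_ge0 ?sumr_ge0 //.
  by have [D0|D0] := real_ge0P (Dr 0 i); rewrite ?addNr // addr_ge0.
exists c; first by rewrite ltr_pwDl ?ltr01 // sumr_ge0.
exists (V ^t* *m diag_mx (\row_i sqrtC (c + D 0 i))).
rewrite adjmxM trmxCK adj_diag_real; last by move=> i; rewrite mxE sqrtC_ge0.
rewrite mulmxA -(mulmxA (V ^t*)) mulmx_diag AE.
have -> : c%:M = V ^t* *m c%:M *m V :> 'M[C]_n.
  by rewrite mul_mx_scalar -scalemxAl V'V scalemx1.
rewrite -mulmxDl -mulmxDr; congr (_ *m _ *m _).
apply/matrixP => i j; rewrite !mxE -expr2 sqrtCK mulrnDl.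
by case: eqP => [->|]; rewrite ?mulr0n ?addr0.
Qed.

Lemma gram_spectral_ge0 n (X : 'M[C]_n) i :
  0 <= spectral_diag (X ^t* *m X) 0 i.
Proof.
have [V [VV' _ XX]] := herm_spectral (herm_gram X).
set D := spectral_diag _ in XX *.
have /matrixP /(_ i i) : (X *m V ^t*) ^t* *m (X *m V ^t*) = diag_mx D.
  rewrite adjmxM trmxCK mulmxA -(mulmxA V) XX.
  by rewrite !mulmxA VV' mul1mx -mulmxA VV' mulmx1.
rewrite [RHS]mxE eqxx mulr1n => <-; rewrite mxE.
apply: sumr_ge0 => j _; rewrite mulrC; set a := (_ *m _) j i.
by rewrite mxE [in X in a * X]mxE -/a -normCK exprn_ge0.
Qed.

(** A singular value decomposition without left singular vectors: the columns of [B] are orthogonal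
    with norms [s], so no orthonormal completion has to be chosen where [s] vanishes. *)
Lemma singular_values n (X : 'M[C]_n) : exists (B V : 'M[C]_n) (s : 'rV[C]_n),
  [/\ V ^t* *m V = 1%:M, X = B *m V,
      B ^t* *m B = diag_mx (\row_i s 0 i ^+ 2),
      forall i, 0 <= s 0 i & trnorm X = \sum_i s 0 i].
Proof.
have [V [VV' V'V XX]] := herm_spectral (herm_gram X).
set D := spectral_diag _ in XX.
have BB : (X *m V ^t*) ^t* *m (X *m V ^t*) = diag_mx D.
  rewrite adjmxM trmxCK mulmxA -(mulmxA V) XX.
  by rewrite !mulmxA VV' mul1mx -mulmxA VV' mulmx1.
exists (X *m V ^t*), V, (\row_i sqrtC (D 0 i)); split=> //.
- by rewrite -mulmxA V'V mulmx1.
- by rewrite BB; congr diag_mx; apply/rowP=> i; rewrite !mxE sqrtCK.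
- by move=> i; rewrite mxE sqrtC_ge0 gram_spectral_ge0.
- by apply: eq_bigr => i _; rewrite mxE.
Qed.

(** Each singular value is split evenly between the two factors, which makes their norms equal and
    the arithmetic-mean bound tight. *)
Lemma trnorm_factor n (X : 'M[C]_n) : exists Y Z : 'M[C]_n,
  [/\ X = Y *m Z ^t*, sqn Y = trnorm X & sqn Z = trnorm X].
Proof.
have [B [V [s [V'V XE BB s0 tX]]]] := singular_values X.
(* [p] stands for [s^(-1/2)]; in this form it is 0 at a zero singular value, because the inverse of
   0 is 0. *)
pose q := \row_i sqrtC (s 0 i); pose p := \row_i ((s 0 i)^-1 * q 0 i).
have q0 i : 0 <= q 0 i by rewrite mxE sqrtC_ge0.
have p0 i : 0 <= p 0 i by rewrite mxE mulr_ge0 ?invr_ge0.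
have qq i : q 0 i * q 0 i = s 0 i by rewrite mxE -expr2 sqrtCK.
have sqnB (t : 'rV[C]_n) : (forall i, 0 <= t 0 i) ->
    sqn (B *m diag_mx t) = \sum_i (t 0 i * s 0 i) ^+ 2.
  move=> t0; rewrite /sqn adjmxM adj_diag_real // mulmxA -(mulmxA _ _ B) BB.
  rewrite -mulmxA !mulmx_diag mxtrace_diag; apply: eq_bigr => i _.
  by rewrite !mxE; ring.
exists (B *m diag_mx p), (V ^t* *m diag_mx q).
rewrite adjmxM trmxCK adj_diag_real // mulmxA -(mulmxA B) mulmx_diag.
set e := \row_ _ _; split.
- have eE i : e 0 i = (s 0 i)^-1 * s 0 i.
    by rewrite !mxE -mulrA -expr2 sqrtCK.
  have e1 i : e 0 i <= 1 /\ 0 <= 1 - e 0 i /\ (1 - e 0 i) * s 0 i = 0.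
    rewrite eE; have [->|sn0] := eqVneq (s 0 i) 0.
      by rewrite !mulr0 subr0; split; rewrite ?ler01 //; split; rewrite ?ler01.
    by rewrite mulVf // subrr lexx mul0r.
  (* [e] is the indicator of the nonzero singular values, and the columns of [B] that it removes
     have norm zero. *)
  have : B *m diag_mx (\row_i (1 - e 0 i)) = 0.
    apply: sqn0_eq0; rewrite sqnB; last by move=> i; rewrite mxE; case: (e1 i) => _ [].
    by apply: big1 => i _; rewrite mxE; case: (e1 i) => _ [_ ->]; rewrite expr0n.
  have -> : diag_mx (\row_i (1 - e 0 i)) = 1%:M - diag_mx e.
    by apply/matrixP => i j; rewrite !mxE mulrnBl.
  by rewrite mulmxBr mulmx1 => /eqP; rewrite subr_eq0 => /eqP <-.
- rewrite sqnB // tX; apply: eq_bigr => i _; rewrite mxE.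
  have [->|sn0] := eqVneq (s 0 i) 0; first by rewrite mulr0 expr0n.
  by rewrite mulrAC mulVf // mul1r expr2 qq.
- rewrite tX /sqn adjmxM trmxCK adj_diag_real // mulmxA.
  rewrite mxtrace_mulC !mulmxA -(mulmxA _ V).
  have -> : V *m V ^t* = 1%:M by exact: mulmx1C.
  rewrite mulmx1 mulmx_diag mxtrace_diag; apply: eq_bigr => i _.
  by rewrite mxE qq.
Qed.

(** The witness is the partial isometry of the polar decomposition: the columns of [B] divided by
    [s] are orthonormal or zero. *)
Lemma trnorm_dual n (X : 'M[C]_n) :
  exists W : 'M[C]_n, contractive W /\ \tr (W ^t* *m X) = trnorm X.
Proof.
have [B [V [s [V'V -> BB s0 ->]]]] := singular_values X.
pose t := \row_i (s 0 i)^-1.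
have t0 i : 0 <= t 0 i by rewrite mxE invr_ge0.
exists (B *m diag_mx t *m V); split=> [p Z|].
- have -> : sqn Z = sqn (V *m Z) by rewrite /sqn adjmxM mulmxA -(mulmxA _ _ V) V'V mulmx1.
  rewrite -mulmxA; set Y := V *m Z; rewrite /sqn.
  have -> : (B *m diag_mx t *m Y) ^t* *m (B *m diag_mx t *m Y) =
      Y ^t* *m ((diag_mx t *m (B ^t* *m B) *m diag_mx t) *m Y).
    by rewrite !adjmxM adj_diag_real // !mulmxA.
  rewrite BB !mulmx_diag.
  rewrite !mxtrace_adjM; apply: ler_sum => j _; apply: ler_sum => i _.
  rewrite mul_diag_mx !mxE mulrCA ler_piMl //; first by rewrite mulrC -normCK exprn_ge0.
  have [->|sn0] := eqVneq (s 0 i) 0; first by rewrite invr0 !mul0r ler01.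
  by rewrite expr2 mulrA mulVf // mul1r divff.
- rewrite !adjmxM adj_diag_real // !mulmxA mxtrace_mulC !mulmxA.
  have -> : V *m V ^t* = 1%:M by exact: mulmx1C.
  rewrite mul1mx -mulmxA BB mulmx_diag mxtrace_diag; apply: eq_bigr => i _.
  rewrite !mxE; have [->|sn0] := eqVneq (s 0 i) 0; first by rewrite invr0 mul0r.
  by rewrite expr2 mulrA mulVf // mul1r.
Qed.

Lemma trnorm_ge0 n (X : 'M[C]_n) : 0 <= trnorm X.
Proof. by have [U [V [_ <- _]]] := trnorm_factor X; apply: sqn_ge0. Qed.

(** Converse of [trnorm_factor]: any factorisation bounds the trace norm, so the test operators of
    the lower bound need no spectral computation. *)
Lemma trnorm_mul_le n p (Y Z : 'M[C]_(n, p)) :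
  trnorm (Y *m Z ^t*) <= (sqn Y + sqn Z) / 2.
Proof.
have [W [Wc tW]] := trnorm_dual (Y *m Z ^t*).
rewrite -(ger0_norm (trnorm_ge0 _)) -tW.
exact: normr_trace_contractive.
Qed.

Lemma normr_trace_le_trnorm n (W X : 'M[C]_n) :
  contractive W -> `|\tr (W ^t* *m X)| <= trnorm X.
Proof.
move=> Wc; have [Y [Z [XE tY tZ]]] := trnorm_factor X.
rewrite {1}XE; apply: le_trans (normr_trace_contractive Y Z Wc) _.
by rewrite tY tZ -mulr2n -[X in X / _](mulr_natr (trnorm X) 2) mulfK ?pnatr_eq0.
Qed.

Lemma trnormZ_le n (a : C) (X : 'M[C]_n) : trnorm (a *: X) <= `|a| * trnorm X.
Proof.
have [W [Wc tW]] := trnorm_dual (a *: X).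
rewrite -(ger0_norm (trnorm_ge0 _)) -tW -scalemxAr mxtraceZ normrM.
by rewrite ler_wpM2l // normr_trace_le_trnorm.
Qed.

End TraceNorm.

Local Open Scope complex_scope.

(** * Kraus representations and the diamond norm *)

Lemma big_mxtens (V : nmodType) m n (f : 'I_(m * n) -> V) :
  \sum_k f k = \sum_i \sum_j f (mxtens_index (i, j)).
Proof.
rewrite pair_big; apply: reindex.
exists (@mxtens_unindex m n) => [[i j] _|k _];
  by rewrite (mxtens_indexK, mxtens_unindexK).
Qed.

Lemma adjmx_tens (C : numClosedFieldType) m n p q
  (A : 'M[C]_(m, n)) (B : 'M[C]_(p, q)) : (A *t B) ^t* = A ^t* *t B ^t*.
Proof. by rewrite trmx_tens map_mxT. Qed.

Lemma hermsymmxP (C : numClosedFieldType) n (A : 'M[C]_n) :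
  reflect (A ^t* = A) (A \is hermsymmx).
Proof.
apply: (iffP (is_hermitianmxP _ _ _)); rewrite expr0 scale1r => /esym //.
Qed.

Lemma adjmx_sumZ (C : numClosedFieldType) m n (I : finType) (e : I -> C)
    (A : I -> 'M[C]_(m, n)) :
  (\sum_k e k *: A k) ^t* = \sum_k (e k)^* *: (A k) ^t*.
Proof.
apply/matrixP => i j; rewrite !mxE !summxE rmorph_sum.
by apply: eq_bigr => k _; rewrite !mxE rmorphM.
Qed.

Section Kraus.
Variable R : realType.
Local Notation C := R[i].

Lemma conjC_real (x : R) : Num.conj (x%:C : C) = x%:C.
Proof. by apply/CrealP; apply/complex_realP; exists x. Qed.

Lemma trace_normE n (X : 'M[C]_n) : (trace_norm X)%:C = trnorm X.
Proof.
rewrite rmorph_sum; apply: eq_bigr => i _ /=.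
have := gram_spectral_ge0 X i; set a := spectral_diag _ _ _ => a0.
have aE : (complex.Re a)%:C = a by rewrite RRe_real ?ger0_real.
have ra0 : 0 <= complex.Re a by rewrite -ler0c aE.
apply/eqP; rewrite -(@eqrXn2 _ 2) ?sqrtC_ge0 ?ler0c ?sqrtr_ge0 //.
by rewrite sqrtCK -rmorphXn sqr_sqrtr //= aE.
Qed.

Lemma ref_blockP r n (A B : 'M[C]_(r * n)) :
  (forall i j, ref_block A i j = ref_block B i j) -> A = B.
Proof.
move=> AB; apply/matrixP => k l.
case: (mxtens_indexP k) => i a; case: (mxtens_indexP l) => j b.
by have /matrixP /(_ a b) := AB i j; rewrite !mxE.
Qed.

Lemma ref_block_id_tens r n m (P : {linear 'M[C]_n -> 'M[C]_m})
  (X : 'M[C]_(r * n)) i j : ref_block (id_tens P X) i j = P (ref_block X i j).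
Proof.
apply/matrixP => a b; rewrite mxE /id_tens summxE (bigD1 i) //=.
rewrite [X in _ + X]big1 ?addr0 => [|k /negbTE ki]; last first.
  rewrite summxE big1 // => l _.
  by rewrite tensmxE mxE [i == k]eq_sym ki mul0r.
rewrite summxE (bigD1 j) //= [X in _ + X]big1 ?addr0 => [|l /negbTE lj].
  by rewrite tensmxE mxE !eqxx mul1r.
by rewrite tensmxE mxE [j == l]eq_sym lj andbF mul0r.
Qed.

Lemma ref_block_conj r n m (K : 'M[C]_(m, n)) (X : 'M[C]_(r * n)) i j :
  ref_block ((1%:M *t K) *m X *m (1%:M *t K) ^t*) i j =
  K *m ref_block X i j *m K ^t*.
Proof.
rewrite adjmx_tens; apply/matrixP => a b; rewrite !mxE big_mxtens.
rewrite (bigD1 j) //= [X in _ + X]big1 ?addr0; last first.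
  move=> l /negbTE lj; apply: big1 => c _.
  by rewrite tensmxE !mxE [j == l]eq_sym lj conjC0 mul0r mulr0.
apply: eq_bigr => c _; rewrite tensmxE !mxE eqxx conjC1 mul1r; congr (_ * _).
rewrite big_mxtens (bigD1 i) //= [X in _ + X]big1 ?addr0; last first.
  move=> l /negbTE li; apply: big1 => ? _.
  by rewrite tensmxE !mxE eq_sym li !mul0r.
by apply: eq_bigr => ? _; rewrite tensmxE !mxE eqxx mul1r.
Qed.

Lemma ref_block_1tens r n (A : 'M[C]_n) (i j : 'I_r) :
  ref_block (1%:M *t A) i j = (i == j)%:R *: A.
Proof. by apply/matrixP => a b; rewrite mxE tensmxE !mxE. Qed.

Lemma ref_block_sumZ r n (I : finType) (e : I -> C) (A : I -> 'M[C]_(r * n)) i j :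
  ref_block (\sum_k e k *: A k) i j = \sum_k e k *: ref_block (A k) i j.
Proof.
apply/matrixP => a b; rewrite mxE !summxE.
by apply: eq_bigr => k _; rewrite !mxE.
Qed.

Section Representation.
Variables (n m : nat) (I : finType) (e : I -> R) (K : I -> 'M[C]_(m, n)).
Variable P : {linear 'M[C]_n -> 'M[C]_m}.
Hypothesis PE : forall X, P X = \sum_k (e k)%:C *: (K k *m X *m (K k) ^t*).

Lemma id_tens_kraus r (X : 'M[C]_(r * n)) : id_tens P X =
  \sum_k (e k)%:C *: ((1%:M *t K k) *m X *m (1%:M *t K k) ^t*).
Proof.
apply: ref_blockP => i j; rewrite ref_block_id_tens PE ref_block_sumZ.
by apply: eq_bigr => k _; rewrite ref_block_conj.
Qed.

Lemma kraus_hp : hermiticity_preserving P.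
Proof.
move=> X /hermsymmxP XX; apply/hermsymmxP; rewrite PE adjmx_sumZ.
apply: eq_bigr => k _; rewrite conjC_real !adjmxM trmxCK XX.
by rewrite mulmxA.
Qed.

Lemma mxtrace_kraus (e' : I -> R) (X : 'M[C]_n) :
  \tr (\sum_k (e' k)%:C *: (K k *m X *m (K k) ^t*)) =
  \tr (X *m \sum_k (e' k)%:C *: ((K k) ^t* *m K k)).
Proof.
rewrite mulmx_sumr !raddf_sum; apply: eq_bigr => k _ /=.
rewrite -scalemxAr !mxtraceZ; congr (_ * _).
by rewrite -mulmxA mxtrace_mulC -mulmxA.
Qed.

Lemma kraus_tp : \sum_k (e k)%:C *: ((K k) ^t* *m K k) = 1%:M ->
  trace_preserving P.
Proof. by move=> KK X; rewrite PE mxtrace_kraus KK mulmx1. Qed.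

Lemma kraus_cp : (forall k, 0 <= e k) -> completely_positive P.
Proof.
move=> e0 r X [/hermsymmxP XX Xpos]; rewrite id_tens_kraus; split.
  apply/hermsymmxP; rewrite adjmx_sumZ; apply: eq_bigr => k _.
  by rewrite conjC_real !adjmxM trmxCK XX mulmxA.
move=> u; rewrite mulmx_sumr mulmx_suml summxE; apply: sumr_ge0 => k _.
rewrite -scalemxAr -scalemxAl mxE mulr_ge0 ?ler0c //.
have := Xpos ((1%:M *t K k) ^t* *m u).
by rewrite adjmxM trmxCK !mulmxA.
Qed.

(** Writing [X = Y Z^*] with balanced factors, every Kraus term is again such a product and costs at
    most the mean of the squared norms of its factors. A negative weight costs its absolute value,
    and the normalisation condition adds the costs up to [l] times the trace norm of [X]. *)
Lemma kraus_diamond_le (l : R) : 0 <= l ->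
  \sum_k (`|e k|)%:C *: ((K k) ^t* *m K k) = l%:C *: 1%:M ->
  (diamond_norm P <= l%:E)%E.
Proof.
move=> l0 KK; apply: ge_ereal_sup => _ [r [X [X1 ->]]]; rewrite lee_fin -lecR.
have [W [Wc tW]] := trnorm_dual (id_tens P X).
have [Y [Z [XE tY tZ]]] := trnorm_factor X.
(* The normalisation condition, extended to the reference by tensoring with the identity. *)
have sqn_sum q (T : 'M[C]_(r * n, q)) :
    \sum_k (`|e k|)%:C * sqn ((1%:M *t K k) *m T) = l%:C * sqn T.
  have -> : l%:C * sqn T = \tr (T ^t* *m ((l%:C *: 1%:M) *m T)).
    by rewrite -scalemxAl mul1mx -scalemxAr mxtraceZ.
  have <- : \sum_k (`|e k|)%:C *: ((1%:M *t K k) ^t* *m (1%:M *t K k)) =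
      l%:C *: (1%:M : 'M[C]_(r * n)).
    apply: ref_blockP => i j; rewrite ref_block_sumZ.
    transitivity ((i == j)%:R *: \sum_k (`|e k|)%:C *: ((K k) ^t* *m K k)).
      rewrite scaler_sumr; apply: eq_bigr => k _.
      rewrite adjmx_tens tensmx_mul trmx1 map_mx1 mulmx1 scalerA mulrC -scalerA.
      by rewrite -ref_block_1tens.
    rewrite KK; apply/matrixP => a b; rewrite !mxE.
    rewrite (can_eq (@mxtens_indexK _ _)) xpair_eqE mulrCA; congr (_ * _).
    by case: (i == j); rewrite ?mul1r ?mul0r.
  rewrite mulmx_suml mulmx_sumr raddf_sum; apply: eq_bigr => k _ /=.
  by rewrite -scalemxAl -scalemxAr mxtraceZ /sqn adjmxM !mulmxA.
rewrite trace_normE -(ger0_norm (trnorm_ge0 _)) -tW id_tens_kraus.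
rewrite mulmx_sumr raddf_sum /=; apply: le_trans (ler_norm_sum _ _ _) _.
apply: (@le_trans _ _ (\sum_k (`|e k|)%:C *
  ((sqn ((1%:M *t K k) *m Y) + sqn ((1%:M *t K k) *m Z)) / 2))).
  apply: ler_sum => k _; rewrite -scalemxAr mxtraceZ normrM.
  have -> : `|(e k)%:C| = (`|e k|)%:C :> C.
    by rewrite normc_def /= expr0n addr0 sqrtr_sqr.
  apply: ler_wpM2l; first by rewrite ler0c.
  have -> : (1%:M *t K k) *m X *m (1%:M *t K k) ^t* =
      ((1%:M *t K k) *m Y) *m ((1%:M *t K k) *m Z) ^t*.
    by rewrite XE adjmxM !mulmxA.
  exact: normr_trace_contractive.
under eq_bigr do rewrite mulrA mulrDr.
rewrite -mulr_suml big_split /= !sqn_sum tY tZ -trace_normE.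
rewrite -mulr2n -[X in X / _]mulr_natr mulfK ?pnatr_eq0 //.
by rewrite -rmorphM lecR -[leRHS]mulr1 ler_wpM2l.
Qed.

End Representation.

(** A lower bound takes an input [X] and a dual witness [W]; the trace norm of the output is never
    computed. *)
Lemma diamond_norm_ge n m (P : {linear 'M[C]_n -> 'M[C]_m}) r
    (X : 'M[C]_(r * n)) (W : 'M[C]_(r * m)) (a : R) :
  trnorm X <= 1 -> contractive W ->
  a%:C <= `|\tr (W ^t* *m id_tens P X)| -> (a%:E <= diamond_norm P)%E.
Proof.
move=> X1 Wc aW; apply: (@le_trans _ _ (trace_norm (id_tens P X))%:E).
  by rewrite lee_fin -lecR trace_normE (le_trans aW) // normr_trace_le_trnorm.
apply: ereal_sup_ubound; exists r, X; split=> //.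
by rewrite -lecR trace_normE.
Qed.

End Kraus.

(** * Choi operators and the linear span of the programs *)

Section OfChoi.
Variable R : realType.
Local Notation C := R[i].

Lemma ref_blockD r n (A B : 'M[C]_(r * n)) i j :
  ref_block (A + B) i j = ref_block A i j + ref_block B i j.
Proof. by apply/matrixP => a b; rewrite !mxE. Qed.

Lemma ref_blockZ r n (a : C) (A : 'M[C]_(r * n)) i j :
  ref_block (a *: A) i j = a *: ref_block A i j.
Proof. by apply/matrixP => ? ?; rewrite !mxE. Qed.

Lemma ref_block_tens r n (A : 'M[C]_r) (B : 'M[C]_n) i j :
  ref_block (A *t B) i j = A i j *: B.
Proof. by apply/matrixP => a b; rewrite mxE tensmxE mxE. Qed.

Lemma tensmxDr m n p q (A : 'M[C]_(m, n)) (B B' : 'M[C]_(p, q)) :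
  A *t (B + B') = A *t B + A *t B'.
Proof. by apply/matrixP => i j; rewrite !mxE mulrDr. Qed.

Lemma tensmxZr m n p q (A : 'M[C]_(m, n)) a (B : 'M[C]_(p, q)) :
  A *t (a *: B) = a *: (A *t B).
Proof. by apply/matrixP => i j; rewrite !mxE mulrCA. Qed.

Lemma tensmxDl m n p q (A A' : 'M[C]_(m, n)) (B : 'M[C]_(p, q)) :
  (A + A') *t B = A *t B + A' *t B.
Proof. by apply/matrixP => i j; rewrite !mxE mulrDl. Qed.

Lemma tensmxZl m n p q a (A : 'M[C]_(m, n)) (B : 'M[C]_(p, q)) :
  (a *: A) *t B = a *: (A *t B).
Proof. by apply/matrixP => i j; rewrite !mxE mulrA. Qed.

Section Fixed.
Variables n m : nat.
Implicit Type J : 'M[C]_(n * m).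

(** The inverse Choi correspondence: the partial trace over the first factor of [(X^T (x) 1) J]. *)
Definition of_choi J (X : 'M[C]_n) : 'M[C]_m :=
  \sum_k \sum_l X k l *: ref_block J k l.

Lemma of_choi_is_linear J : linear (of_choi J).
Proof.
move=> a X Y; rewrite scaler_sumr -big_split; apply: eq_bigr => k _ /=.
rewrite scaler_sumr -big_split; apply: eq_bigr => l _ /=.
by rewrite !mxE scalerDl scalerA.
Qed.

HB.instance Definition _ J :=
  GRing.isLinear.Build C 'M[C]_n 'M[C]_m *:%R (of_choi J) (of_choi_is_linear J).

Lemma of_choi_delta J i j : of_choi J (delta_mx i j) = ref_block J i j.
Proof.
rewrite /of_choi (bigD1 i) //= [X in _ + X]big1 ?addr0 => [|k /negbTE ki].
  rewrite (bigD1 j) //= [X in _ + X]big1 ?addr0 => [|l /negbTE lj].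
    by rewrite mxE !eqxx scale1r.
  by rewrite mxE lj andbF scale0r.
by apply: big1 => l _; rewrite mxE ki scale0r.
Qed.

Lemma of_choiD J J' X : of_choi (J + J') X = of_choi J X + of_choi J' X.
Proof.
rewrite -big_split; apply: eq_bigr => k _ /=.
rewrite -big_split; apply: eq_bigr => l _ /=.
by rewrite ref_blockD scalerDr.
Qed.

Lemma of_choiZ a J X : of_choi (a *: J) X = a *: of_choi J X.
Proof.
rewrite scaler_sumr; apply: eq_bigr => k _ /=.
rewrite scaler_sumr; apply: eq_bigr => l _ /=.
by rewrite ref_blockZ scalerA mulrC -scalerA.
Qed.

Lemma ref_block_choi (E : {linear 'M[C]_n -> 'M[C]_m}) i j :
  ref_block (choi E) i j = E (delta_mx i j).
Proof.
(* The unnormalised maximally entangled operator, whose block at [(k, l)] is the matrix unit; the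
   Choi operator is the image of [X] under [id (x) E]. *)
pose X : 'M[C]_(n * n) := \matrix_(p, q)
  (((mxtens_unindex p).1 == (mxtens_unindex p).2)%:R *
   ((mxtens_unindex q).1 == (mxtens_unindex q).2)%:R).
have XE k l : ref_block X k l = delta_mx k l.
  apply/matrixP => a b; rewrite !mxE !mxtens_indexK /=.
  by rewrite [a == k]eq_sym [b == l]eq_sym mulr_natr mulrb; case: eqP; case: eqP.
rewrite -[in RHS]XE -ref_block_id_tens; congr ref_block.
by apply: eq_bigr => k _; apply: eq_bigr => l _; rewrite XE.
Qed.

Lemma of_choiK J : choi (of_choi J) = J.
Proof.
by apply: ref_blockP => i j; rewrite ref_block_choi /= of_choi_delta.
Qed.

Lemma choiK (E : {linear 'M[C]_n -> 'M[C]_m}) X : of_choi (choi E) X = E X.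
Proof.
rewrite [in RHS](matrix_sum_delta X) linear_sum; apply: eq_bigr => i _.
rewrite linear_sum; apply: eq_bigr => j _.
by rewrite ref_block_choi linearZ.
Qed.

(** Column [j] of [Y] unvectorised: a Gram factor of a Choi operator is a list of Kraus
    operators. *)
Definition kraus_op p (Y : 'M[C]_(n * m, p)) (j : 'I_p) : 'M[C]_(m, n) :=
  \matrix_(a, k) Y (mxtens_index (k, a)) j.

Lemma of_choi_gram p (Y : 'M[C]_(n * m, p)) X :
  of_choi (Y *m Y ^t*) X =
  \sum_j kraus_op Y j *m X *m (kraus_op Y j) ^t*.
Proof.
apply/matrixP => a b; rewrite !summxE.
under eq_bigr => k _.
  rewrite summxE; under eq_bigr => l _ do rewrite !mxE mulr_sumr.
  rewrite exchange_big; over.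
rewrite exchange_big; apply: eq_bigr => j _ /=.
rewrite mxE exchange_big; apply: eq_bigr => l _ /=.
rewrite !mxE mulr_suml; apply: eq_bigr => k _.
by rewrite !mxE; ring.
Qed.

Lemma of_choi_cp p (Y : 'M[C]_(n * m, p)) (a : R) : 0 <= a ->
  completely_positive (of_choi (a%:C *: (Y *m Y ^t*))).
Proof.
move=> a0; apply: (@kraus_cp _ _ _ 'I_p (fun=> a) (kraus_op Y)) => // X.
by rewrite /= of_choiZ of_choi_gram scaler_sumr.
Qed.

Lemma of_choi_tp J :
  (forall k l, \tr (ref_block J k l) = (k == l)%:R) ->
  trace_preserving (of_choi J).
Proof.
move=> trJ X; rewrite raddf_sum; apply: eq_bigr => k _ /=.
rewrite raddf_sum (bigD1 k) //= [X in _ + X]big1 ?addr0 => [|l lk].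
  by rewrite mxtraceZ trJ eqxx mulr1.
by rewrite mxtraceZ trJ eq_sym (negbTE lk) mulr0.
Qed.

End Fixed.

(** * Exactness extended from programs to their linear span *)

Section Extension.
Variables (d : nat) (d_gt0 : (0 < d)%N).
Variable P : {linear 'M[C]_(d * (d * d)) -> 'M[C]_d}.
Hypothesis Pexact : exact_programming (real_channels R d) P.

Let dC_gt0 : 0 < d%:R :> C. Proof. by rewrite ltr0n. Qed.
Let dC_neq0 : d%:R != 0 :> C. Proof. by rewrite gt_eqF. Qed.

Lemma ref_block_scalar (c : C) (i j : 'I_d) :
  ref_block (c%:M : 'M[C]_(d * d)) i j = (c * (i == j)%:R)%:M.
Proof.
apply/matrixP => a b; rewrite !mxE (can_eq (@mxtens_indexK _ _)) xpair_eqE.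
by case: (i == j); rewrite /= ?mulr1 // mulr0 mulr0n mul0rn.
Qed.

(** Divided by [c d], the operator [c + J] is the Choi operator of a real channel: the Gram factor
    gives complete positivity, and the traceless blocks of [J] leave the trace condition to [c]. By
    linearity the rescaling cancels. *)
Lemma exact_shifted (rho : 'M[C]_d) (J Y : 'M[C]_(d * d)) (c : C) :
  is_state rho -> J \is a realmx ->
  (forall k l, \tr (ref_block J k l) = 0) -> 0 < c -> c%:M + J = Y *m Y ^t* ->
  P (rho *t (c%:M + J)) = d%:R *: of_choi (c%:M + J) rho.
Proof.
move=> rho_st Jr trJ c0 JE; have [_ HP] := Pexact.
pose a := (c * d%:R)^-1.
have a0 : 0 < a by rewrite invr_gt0 mulr_gt0.
have aE : (complex.Re a)%:C = a by rewrite RRe_real ?gtr0_real.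
have : real_channels R d (of_choi (a *: (c%:M + J))).
  split; first split.
  - rewrite -aE JE; apply: of_choi_cp.
    by rewrite -ler0c aE ltW.
  - apply: of_choi_tp => k l; rewrite ref_blockZ ref_blockD ref_block_scalar.
    rewrite mxtraceZ mxtraceD trJ addr0 mxtrace_scalar -[X in a * X]mulr_natr.
    rewrite [c * _ * _]mulrAC mulrA.
    by rewrite mulVf ?mul1r // mulf_neq0 // gt_eqF.
  - rewrite of_choiK; apply/mxOverP => i j; rewrite !mxE.
    rewrite rpredM ?rpredD ?(gtr0_real a0) ?(mxOverP Jr) //.
    by rewrite rpredMn // gtr0_real.
move=> /(HP rho _ rho_st); rewrite /program_state of_choiK /= of_choiZ.
rewrite !tensmxZr !linearZ /= => PE.
have da_neq0 : d%:R^-1 * a != 0 by exact: mulf_neq0 (invr_neq0 dC_neq0) (lt0r_neq0 a0).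
apply: (scalerI da_neq0); rewrite -scalerA PE scalerA mulrAC.
by rewrite (mulVf dC_neq0) mul1r.
Qed.

Lemma exact_on_states (rho : 'M[C]_d) (J : 'M[C]_(d * d)) :
  is_state rho -> J \is hermsymmx -> J \is a realmx ->
  (forall k l, \tr (ref_block J k l) = 0) ->
  P (rho *t J) = d%:R *: of_choi J rho.
Proof.
move=> rho_st Jh Jr trJ; have [c c0 [Y JE]] := herm_shift Jh.
have := exact_shifted rho_st Jr trJ c0 JE.
(* The same shift with [J = 0] is a multiple of the completely depolarising program; subtracting it
   leaves [J] alone. *)
have c1 : c%:M + 0 = (sqrtC c)%:M *m (sqrtC c)%:M ^t* :> 'M[C]_(d * d).
  rewrite addr0 adj_scalar geC0_conj ?sqrtC_ge0 ?ltW //.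
  by rewrite -scalar_mxM -expr2 sqrtCK.
have r0 : (0 : 'M[C]_(d * d)) \is a realmx by apply/mxOverP => i j; rewrite mxE.
have t0 k l : \tr (ref_block (0 : 'M[C]_(d * d)) k l) = 0.
  by apply: big1 => i _; rewrite !mxE.
have := exact_shifted rho_st r0 t0 c0 c1; rewrite addr0.
rewrite tensmxDr linearD of_choiD scalerDr /= => ->.
exact: addrI.
Qed.

Lemma psd_gram n p (Y : 'M[C]_(n, p)) : psdmx (Y *m Y ^t*).
Proof.
split; first by apply/hermsymmxP; rewrite adjmxM trmxCK.
move=> u; rewrite mulmxA -mulmxA -{1}[Y]trmxCK -adjmxM.
move: (_ *m u) => v; rewrite mxE; apply: sumr_ge0 => j _.
by rewrite 2!mxE mulrC -normCK exprn_ge0.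
Qed.

(** Both sides are linear in [X], and states span all matrices: positive matrices are multiples of
    states, Hermitian ones are differences of positive ones, and Hermitian ones span over the
    complex numbers. *)
Lemma exact_extends (X : 'M[C]_d) (J : 'M[C]_(d * d)) :
  J \is hermsymmx -> J \is a realmx ->
  (forall k l, \tr (ref_block J k l) = 0) ->
  P (X *t J) = d%:R *: of_choi J X.
Proof.
move=> Jh Jr trJ.
pose g X := P (X *t J) - d%:R *: of_choi J X.
have gD A B : g (A + B) = g A + g B.
  by rewrite /g tensmxDl linearD [of_choi J _]linearD /= scalerDr opprD addrACA.
have gZ a A : g (a *: A) = a *: g A.
  rewrite /g tensmxZl linearZ [of_choi J _]linearZ /= scalerBr; congr (_ - _).
  by rewrite !scalerA mulrC.
have g_gram Y : g (Y *m Y ^t*) = 0.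
  (* A positive matrix of trace zero cannot be normalised to a state, but it vanishes. *)
  set A := Y *m Y ^t*; have [tA0|tA0] := eqVneq (\tr A) 0.
    have -> : A = 0 *: A.
      have /sqn0_eq0 Y0 : sqn Y = 0 by rewrite /sqn mxtrace_mulC.
      by rewrite /A Y0 mul0mx scaler0.
    by rewrite gZ scale0r.
  have tA : 0 < \tr A.
    by rewrite lt_def tA0 /A mxtrace_mulC; apply: sqn_ge0.
  have : is_state ((\tr A)^-1 *: A).
    split; last by rewrite mxtraceZ mulVf.
    have -> : (\tr A)^-1 *: A =
        (sqrtC (\tr A)^-1 *: Y) *m (sqrtC (\tr A)^-1 *: Y) ^t*.
      rewrite adjmxZ -scalemxAl -scalemxAr scalerA geC0_conj.
        by rewrite -expr2 sqrtCK.
      by rewrite sqrtC_ge0 invr_ge0 ltW.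
    exact: psd_gram.
  move=> /exact_on_states /(_ Jh Jr trJ) /eqP; rewrite -subr_eq0 => /eqP.
  rewrite -/(g _) gZ => /eqP; rewrite scaler_eq0 invr_eq0 (negbTE tA0) /=.
  by move=> /eqP.
have g_herm H : H \is hermsymmx -> g H = 0.
  move=> /herm_shift [c c0 [Y HE]].
  have gc : g c%:M = 0.
    have -> : c%:M = (sqrtC c)%:M *m (sqrtC c)%:M ^t* :> 'M[C]_d.
      rewrite adj_scalar geC0_conj ?sqrtC_ge0 ?ltW //.
      by rewrite -scalar_mxM -expr2 sqrtCK.
    exact: g_gram.
  by have := g_gram _ Y; rewrite -HE gD gc add0r.
apply/eqP; rewrite -subr_eq0 -/(g X); apply/eqP.
(* Decomposition into Hermitian and anti-Hermitian parts, the latter multiplied by [i] to become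
   Hermitian. *)
have -> : X = 2^-1 *: (X + X ^t*) + (- 'i%R / 2) *: ('i%R *: (X - X ^t*)).
  rewrite scalerA mulrAC mulNr -expr2 sqrCi opprK mul1r -scalerDr.
  rewrite addrACA subrr addr0 -mulr2n -[X *+ 2]scaler_nat scalerA.
  by rewrite mulVf ?scale1r ?pnatr_eq0.
rewrite gD 2!gZ !g_herm ?scaler0 ?addr0 //; apply/hermsymmxP.
  by rewrite adjmxZ adjmxB trmxCK conjCi scaleNr -scalerN opprB.
by rewrite adjmxD trmxCK addrC.
Qed.

End Extension.
End OfChoi.

(** * Lower bound *)

Lemma sum_pickl (S : pzRingType) (I : finType) (j : I) (f : I -> S) :
  \sum_i (i == j)%:R * f i = f j.
Proof.
rewrite (bigD1 j) //= eqxx mul1r big1 ?addr0 // => i /negbTE ->.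
by rewrite mul0r.
Qed.

Lemma sum_pickr (S : pzRingType) (I : finType) (j : I) (f : I -> S) :
  \sum_i (j == i)%:R * f i = f j.
Proof. by rewrite -[RHS]sum_pickl; apply: eq_bigr => i _; rewrite eq_sym. Qed.

Lemma exchange_big4 (V : nmodType) (I : finType) (F : I -> I -> I -> I -> V) :
  \sum_k \sum_l \sum_i \sum_j F i j k l =
  \sum_i \sum_j \sum_k \sum_l F i j k l.
Proof.
under eq_bigr do rewrite exchange_big /=.
rewrite exchange_big; apply: eq_bigr => i _ /=.
by under eq_bigr do rewrite exchange_big /=; rewrite exchange_big.
Qed.

(** * Omega, the swap, and the test operators built from them *)

Section Bipartite.
Variables (R : realType) (d : nat).
Local Notation C := R[i].

Definition omega_mx : 'M[C]_(d * d) := \matrix_(p, q)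
  (((mxtens_unindex p).1 == (mxtens_unindex p).2)%:R *
   ((mxtens_unindex q).1 == (mxtens_unindex q).2)%:R).

Definition swap_mx : 'M[C]_(d * d) := \matrix_(p, q)
  (((mxtens_unindex p).1 == (mxtens_unindex q).2)%:R *
   ((mxtens_unindex p).2 == (mxtens_unindex q).1)%:R).

Lemma omega_mxE i j k l : omega_mx (mxtens_index (i, j)) (mxtens_index (k, l)) =
  (i == j)%:R * (k == l)%:R.
Proof. by rewrite mxE !mxtens_indexK. Qed.

Lemma swap_mxE i j k l : swap_mx (mxtens_index (i, j)) (mxtens_index (k, l)) =
  (i == l)%:R * (j == k)%:R.
Proof. by rewrite mxE !mxtens_indexK. Qed.

Lemma omega_adj : omega_mx ^t* = omega_mx.
Proof.
by apply/matrixP => p q; rewrite !mxE rmorphM !rmorph_nat mulrC.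
Qed.

Lemma swap_adj : swap_mx ^t* = swap_mx.
Proof.
apply/matrixP => p q; rewrite !mxE rmorphM !rmorph_nat mulrC.
by congr (_%:R * _%:R); rewrite eq_sym.
Qed.

Lemma omega_omega : omega_mx *m omega_mx = d%:R *: omega_mx.
Proof.
apply/matrixP => p q.
case: (mxtens_indexP p) => i j; case: (mxtens_indexP q) => k l.
rewrite !mxE big_mxtens !mxtens_indexK /=.
transitivity (\sum_(m < d) ((i == j)%:R * (k == l)%:R : C)).
  apply: eq_bigr => m _; rewrite -[RHS]mul1r.
  transitivity (\sum_n (m == n)%:R * ((m == n)%:R * ((i == j)%:R * (k == l)%:R)) : C).
    by apply: eq_bigr => n _; rewrite !omega_mxE; ring.
  by rewrite sum_pickr eqxx.
by rewrite sumr_const card_ord -[LHS]mulr_natl.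
Qed.

Lemma swap_swap : swap_mx *m swap_mx = 1%:M.
Proof.
apply/matrixP => p q.
case: (mxtens_indexP p) => i j; case: (mxtens_indexP q) => k l.
rewrite !mxE big_mxtens /=.
transitivity (\sum_m (j == m)%:R * \sum_n (i == n)%:R *
  ((m == l)%:R * (n == k)%:R) : C).
  apply: eq_bigr => m _; rewrite mulr_sumr; apply: eq_bigr => n _.
  by rewrite !swap_mxE; ring.
rewrite sum_pickr sum_pickr (can_eq (@mxtens_indexK _ _)) xpair_eqE.
by rewrite -mulnb natrM mulrC.
Qed.

Lemma swap_omega : swap_mx *m omega_mx = omega_mx.
Proof.
apply/matrixP => p q.
case: (mxtens_indexP p) => i j; case: (mxtens_indexP q) => k l.
rewrite !mxE big_mxtens !mxtens_indexK /=.
transitivity (\sum_m (j == m)%:R * \sum_n (i == n)%:R *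
  ((m == n)%:R * (k == l)%:R) : C).
  apply: eq_bigr => m _; rewrite mulr_sumr; apply: eq_bigr => n _.
  by rewrite swap_mxE omega_mxE; ring.
by rewrite sum_pickr sum_pickr [j == i]eq_sym.
Qed.

Lemma omega_swap : omega_mx *m swap_mx = omega_mx.
Proof.
by rewrite -[LHS]trmxCK adjmxM swap_adj omega_adj swap_omega omega_adj.
Qed.

Let E (i j : 'I_d) : 'M[C]_d := delta_mx i j.

Lemma adj_delta m n i j : (delta_mx i j : 'M[C]_(m, n)) ^t* = delta_mx j i.
Proof. by rewrite trmx_delta map_delta_mx. Qed.

Lemma trace_delta n (i j : 'I_n) : \tr (delta_mx i j : 'M[C]_n) = (i == j)%:R.
Proof.
rewrite -[RHS](sum_pickl i (fun k => (k == j)%:R)).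
by apply: eq_bigr => k _; rewrite mxE -mulnb natrM.
Qed.

(* With the reference C' as leading factor, [swap_left *m swap_right ^t*] is
   Omega_{C'C} (x) F_{AB}; both factors have 0/1 entries, so their Frobenius norms,
   which bound the trace norm, are counted rather than computed. *)
Definition swap_left : 'M[C]_(d * (d * (d * d)), d * d) := \matrix_(p, q)
  (((mxtens_unindex (mxtens_unindex p).2).1 == (mxtens_unindex q).2)%:R *
   ((mxtens_unindex (mxtens_unindex (mxtens_unindex p).2).2).1 ==
      (mxtens_unindex q).1)%:R *
   ((mxtens_unindex (mxtens_unindex (mxtens_unindex p).2).2).2 ==
      (mxtens_unindex p).1)%:R).

Definition swap_right : 'M[C]_(d * (d * (d * d)), d * d) := \matrix_(p, q)
  (((mxtens_unindex (mxtens_unindex p).2).1 == (mxtens_unindex q).1)%:R *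
   ((mxtens_unindex (mxtens_unindex (mxtens_unindex p).2).2).1 ==
      (mxtens_unindex q).2)%:R *
   ((mxtens_unindex (mxtens_unindex (mxtens_unindex p).2).2).2 ==
      (mxtens_unindex p).1)%:R).

(** The vector of Omega_AB (x) Omega_C'C, with factors in the order C', A, B, C; the test operator
    has rank one, so its trace norm is the squared norm of this vector. *)
Definition omega_col : 'cV[C]_(d * (d * (d * d))) := \col_p
  (((mxtens_unindex (mxtens_unindex p).2).1 ==
     (mxtens_unindex (mxtens_unindex (mxtens_unindex p).2).2).1)%:R *
   ((mxtens_unindex (mxtens_unindex (mxtens_unindex p).2).2).2 ==
      (mxtens_unindex p).1)%:R).

(** The block is F on AB tensored with a matrix unit on C. It stays expanded in matrix units because
    exactness is evaluated term by term on them. *)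
Lemma ref_block_swap k l : ref_block (swap_left *m swap_right ^t*) k l =
  \sum_i \sum_j E i j *t (E j i *t E k l).
Proof.
apply/matrixP => p q.
case: (mxtens_indexP p) => a p'; case: (mxtens_indexP p') => b c.
case: (mxtens_indexP q) => a' q'; case: (mxtens_indexP q') => b' c'.
rewrite !mxE summxE big_mxtens exchange_big; apply: eq_bigr => i _.
rewrite summxE; apply: eq_bigr => j _.
rewrite !mxE !mxtens_indexK /= !rmorphM !rmorph_nat -!mulnb !natrM.
by ring.
Qed.

Lemma ref_block_omega k l : ref_block (omega_col *m omega_col ^t*) k l =
  \sum_i \sum_j E i j *t (E i j *t E k l).
Proof.
apply/matrixP => p q.
case: (mxtens_indexP p) => a p'; case: (mxtens_indexP p') => b c.
case: (mxtens_indexP q) => a' q'; case: (mxtens_indexP q') => b' c'.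
rewrite !mxE summxE big_ord1 !mxE !mxtens_indexK /= !rmorphM !rmorph_nat.
transitivity (\sum_i (a == i)%:R * ((b == i)%:R * (c == k)%:R *
  \sum_j ((a' == j)%:R * ((b' == j)%:R * (c' == l)%:R))) : C).
  by rewrite sum_pickr sum_pickr [b == a]eq_sym [b' == a']eq_sym.
apply: eq_bigr => i _; rewrite summxE !mulr_sumr; apply: eq_bigr => j _.
rewrite !mxE !mxtens_indexK /= -!mulnb !natrM.
by ring.
Qed.

Lemma sqn_bool m n (A : 'M[C]_(m, n)) :
  (forall i j, A i j = 0 \/ A i j = 1) -> sqn A = \sum_j \sum_i A i j.
Proof.
move=> A01; rewrite sqnE; apply: eq_bigr => j _; apply: eq_bigr => i _.
by case: (A01 i j) => ->; rewrite ?normr0 ?normr1 ?expr0n ?expr1n.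
Qed.


Lemma sqn_swap_left : sqn swap_left = d%:R ^+ 3.
Proof.
rewrite sqn_bool => [|p q]; last first.
  by rewrite mxE; do ?case: eqP => _; rewrite ?mulr0 ?mul0r ?mulr1; [right|left..].
transitivity (\sum_(j < d * d) \sum_(k < d) (1 : C)); last first.
  by rewrite !sumr_const !card_ord -mulrnA -natrX; congr (_%:R).
apply: eq_bigr => q _; rewrite big_mxtens; apply: eq_bigr => k _.
case: (mxtens_indexP q) => i j; rewrite big_mxtens.
transitivity (\sum_a (a == j)%:R * \sum_b (b == i)%:R *
  \sum_c (c == k)%:R * 1 : C); last by rewrite !sum_pickl.
apply: eq_bigr => a _; rewrite big_mxtens mulr_sumr; apply: eq_bigr => b _.
rewrite !mulr_sumr; apply: eq_bigr => c _.
by rewrite mxE !mxtens_indexK /=; ring.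
Qed.

Lemma sqn_swap_right : sqn swap_right = d%:R ^+ 3.
Proof.
rewrite sqn_bool => [|p q]; last first.
  by rewrite mxE; do ?case: eqP => _; rewrite ?mulr0 ?mul0r ?mulr1; [right|left..].
transitivity (\sum_(j < d * d) \sum_(k < d) (1 : C)); last first.
  by rewrite !sumr_const !card_ord -mulrnA -natrX; congr (_%:R).
apply: eq_bigr => q _; rewrite big_mxtens; apply: eq_bigr => k _.
case: (mxtens_indexP q) => i j; rewrite big_mxtens.
transitivity (\sum_a (a == i)%:R * \sum_b (b == j)%:R *
  \sum_c (c == k)%:R * 1 : C); last by rewrite !sum_pickl.
apply: eq_bigr => a _; rewrite big_mxtens mulr_sumr; apply: eq_bigr => b _.
rewrite !mulr_sumr; apply: eq_bigr => c _.
by rewrite mxE !mxtens_indexK /=; ring.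
Qed.

Lemma sqn_omega_col : sqn omega_col = d%:R ^+ 2.
Proof.
rewrite sqn_bool => [|p q]; last first.
  by rewrite mxE; do ?case: eqP => _; rewrite ?mulr0 ?mul0r ?mulr1; [right|left..].
rewrite big_ord1 big_mxtens.
transitivity (\sum_(k < d) \sum_(a < d) (1 : C)); last first.
  by rewrite !sumr_const !card_ord -mulrnA -natrX; congr (_%:R).
apply: eq_bigr => k _; rewrite big_mxtens; apply: eq_bigr => a _.
transitivity (\sum_b (a == b)%:R * \sum_c (c == k)%:R * 1 : C); last first.
  by rewrite sum_pickl sum_pickr.
rewrite big_mxtens; apply: eq_bigr => b _; rewrite !mulr_sumr; apply: eq_bigr => c _.
by rewrite mxE !mxtens_indexK /=; ring.
Qed.

Lemma mxtrace_swap (M : 'M[C]_(d * d)) :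
  \tr (swap_mx ^t* *m M) = \sum_k \sum_l ref_block M k l l k.
Proof.
rewrite swap_adj exchange_big /mxtrace big_mxtens.
apply: eq_bigr => k _; apply: eq_bigr => l _; rewrite mxE big_mxtens mxE.
transitivity (\sum_m (l == m)%:R * \sum_n (k == n)%:R *
    M (mxtens_index (m, n)) (mxtens_index (k, l))); last by rewrite !sum_pickr.
apply: eq_bigr => m _; rewrite mulr_sumr; apply: eq_bigr => n _.
by rewrite swap_mxE; ring.
Qed.

Lemma mxtrace_omega (M : 'M[C]_(d * d)) :
  \tr (omega_mx ^t* *m M) = \sum_k \sum_l ref_block M k l k l.
Proof.
rewrite omega_adj exchange_big /mxtrace big_mxtens.
apply: eq_bigr => k _.
transitivity (\sum_l (k == l)%:R * \sum_m \sum_n (m == n)%:R *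
    M (mxtens_index (m, n)) (mxtens_index (k, l))).
  apply: eq_bigr => l _; rewrite mxE big_mxtens mulr_sumr.
  apply: eq_bigr => m _; rewrite mulr_sumr; apply: eq_bigr => n _.
  by rewrite omega_mxE; ring.
by rewrite sum_pickr; apply: eq_bigr => m _; rewrite sum_pickr mxE.
Qed.

Lemma mxtrace_blocks r n (M : 'M[C]_(r * n)) : \tr M = \sum_k \tr (ref_block M k k).
Proof.
rewrite /mxtrace big_mxtens; apply: eq_bigr => k _; apply: eq_bigr => a _.
by rewrite mxE.
Qed.

Lemma mxtrace_tens n m (A : 'M[C]_n) (B : 'M[C]_m) : \tr (A *t B) = \tr A * \tr B.
Proof.
rewrite mxtrace_blocks mulr_suml; apply: eq_bigr => k _.
by rewrite ref_block_tens mxtraceZ.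
Qed.

Hypothesis d_gt0 : (0 < d)%N.
Let d_neq0 : d%:R != 0 :> C. Proof. by rewrite pnatr_eq0 -lt0n. Qed.
Let dC_gt0 : 0 < d%:R :> C. Proof. by rewrite ltr0n. Qed.

Definition omega_reflection : 'M[C]_(d * d) := (2 / d%:R) *: omega_mx - 1%:M.

Lemma omega_reflection_unitary : omega_reflection ^t* *m omega_reflection = 1%:M.
Proof.
have adjE : omega_reflection ^t* = omega_reflection.
  rewrite adjmxB adjmxZ omega_adj adj_scalar conjC1 rmorphM fmorphV.
  by rewrite !rmorph_nat.
rewrite adjE mulmxBl !mulmxBr mulmx1 !mul1mx -scalemxAl -scalemxAr omega_omega.
rewrite !scalerA; set a := _ / _; have -> : a * a * d%:R = a + a.
  by rewrite /a; field.
by rewrite scalerDl opprB addrA addrK addrAC subrr add0r.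
Qed.

(** The weights 2 and 1 bound [lam] by an average of the two moduli, hence by the larger one.
    Choosing the larger one avoids arithmetic on [D], which may be infinite. *)
Lemma weighted_bound (D : \bar R) (x y : C) (lam : R) :
  2 * x + y = (3 * lam)%:C ->
  (forall a : R, a%:C <= `|x| -> (a%:E <= D)%E) ->
  (forall b : R, b%:C <= `|y| -> (b%:E <= D)%E) -> (lam%:E <= D)%E.
Proof.
move=> lamE Dx Dy.
have normE (z : C) : exists a : R, a%:C = `|z|.
  by exists (complex.Re `|z|); rewrite RRe_real ?normr_real.
have [[a aE] [b bE]] := (normE x, normE y).
have lam_le : 3 * lam <= 2 * a + b.
  suff : (3 * lam)%:C <= (2 * a + b)%:C :> C by rewrite lecR.
  have -> : (2 * a + b)%:C = `|2 * x| + `|y| :> C.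
    by rewrite rmorphD rmorphM rmorph_nat /= aE bE normrM normr_nat.
  apply: le_trans (ler_normD _ _); rewrite lamE real_ler_norm //.
  by apply/complex_realP; exists (3 * lam).
have {}Dx : (a%:E <= D)%E by apply: Dx; rewrite aE.
have {}Dy : (b%:E <= D)%E by apply: Dy; rewrite bE.
have [ab|ab] := leP a b.
  by apply: le_trans Dy; rewrite lee_fin; lra.
by apply: le_trans Dx; rewrite lee_fin; lra.
Qed.

(** * Linear constraints imposed by exactness, and the lower bound *)

Section Lower.
Variable P : {linear 'M[C]_(d * (d * d)) -> 'M[C]_d}.
Hypothesis Pexact : exact_programming (real_channels R d) P.

(* The transpositions in F on AB and on CD cancel in this combination, so [S] is
   symmetric: it is a combination of programs as soon as its partial trace over
   the output vanishes. *)
Let S (i j k l : 'I_d) := E i j *t E k l + E j i *t E l k.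

Lemma exact_offdiag i j k l : k != l -> P (E i j *t S i j k l) k l = d%:R.
Proof.
move=> kl; rewrite (exact_extends d_gt0 Pexact).
- rewrite of_choi_delta ref_blockD !ref_block_tens !mxE !eqxx /=.
  by rewrite [l == k]eq_sym (negbTE kl) andbF mulr0 addr0 !mulr1.
- apply/hermsymmxP; rewrite adjmxD !adjmx_tens !adj_delta addrC.
  by [].
- by apply/mxOverP => p q; rewrite !mxE rpredD ?rpredM ?rpred_nat.
- move=> a b; rewrite ref_blockD !ref_block_tens mxtraceD !mxtraceZ !trace_delta.
  by rewrite [l == k]eq_sym (negbTE kl) !mulr0 addr0.
Qed.

(* For [k = l] the remainder proportional to the identity on the output is not a
   combination of programs; summed over [k] it is fixed by trace preservation. *)
Lemma exact_diag i j k : P (E i j *t S i j k k) k k =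
  (1 + (i == j)%:R) * (d%:R - 1) + d%:R^-1 * P (E i j *t ((E i j + E j i) *t 1%:M)) k k.
Proof.
pose T := (E i j + E j i) *t (E k k - d%:R^-1 *: 1%:M).
have -> : S i j k k = T + d%:R^-1 *: ((E i j + E j i) *t 1%:M).
  by rewrite /T -tensmxZr -tensmxDr subrK tensmxDl.
rewrite tensmxDr tensmxZr linearD linearZ /= [in LHS]mxE [(_ *: P _) _ _]mxE.
congr (_ + _); rewrite (exact_extends d_gt0 Pexact).
- rewrite of_choi_delta ref_block_tens !mxE !eqxx /= [j == i]eq_sym andbb mulr1.
  by field.
- apply/hermsymmxP; rewrite adjmx_tens adjmxD adjmxB adjmxZ adj_scalar !adj_delta.
  by rewrite addrC conjC1 fmorphV rmorph_nat.
- apply/mxOverP => p q; rewrite !mxE rpredM ?rpredD ?rpredN ?rpred_nat //.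
  by rewrite rpredM ?rpredV ?rpred_nat // rpredMn ?rpred1.
- move=> a b; rewrite ref_block_tens mxtraceZ mxtraceD raddfN /= mxtraceZ.
  rewrite trace_delta eqxx mxtrace1 mulVf // subrr mulr0.
  by [].
Qed.

(** The first term counts [d (d - 1)] off-diagonal pairs contributing [d] each, the second comes
    from the [d] diagonal terms, and the third is the remainder proportional to the identity on the
    output. *)
Lemma exact_sum i j : \sum_k \sum_l P (E i j *t S i j k l) k l =
  d%:R ^+ 2 * (d%:R - 1) + (1 + (i == j)%:R) * (d%:R - 1) * d%:R + 2 * (i == j)%:R.
Proof.
have [[_ TP] _] := Pexact.
transitivity (\sum_k (d%:R * (d%:R - 1) + P (E i j *t S i j k k) k k)).
  apply: eq_bigr => k _; rewrite (bigD1 k) //= addrC; congr (_ + _).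
  rewrite (eq_bigr (fun=> d%:R)) => [|l]; last first.
    by rewrite eq_sym; apply: exact_offdiag.
  rewrite sumr_const cardC1 card_ord -[LHS]mulr_natr; congr (_ * _).
  by rewrite -subn1 natrB.
rewrite big_split /= sumr_const card_ord.
under eq_bigr do rewrite exact_diag.
rewrite big_split /= sumr_const card_ord -mulr_sumr.
(* Summed over [k], the remainder is the trace of one value of [P], hence the trace of the input. *)
have -> : \sum_k P (E i j *t ((E i j + E j i) *t 1%:M)) k k =
    2 * (i == j)%:R * d%:R.
  rewrite -[LHS]/(\tr _) TP mxtrace_blocks (eq_bigr (fun k => (i == k)%:R *
    ((j == k)%:R * (2 * (i == j)%:R * d%:R)))) ?sum_pickr.
    by rewrite [j == i]eq_sym; case: (i == j); rewrite ?mul1r // !(mul0r, mulr0).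
  move=> k _; rewrite ref_block_tens mxtraceZ mxtrace_blocks.
  rewrite mxE -mulnb natrM [k == i]eq_sym [k == j]eq_sym -mulrA.
  congr (_ * (_ * _)).
  under eq_bigr do rewrite ref_block_tens mxtraceZ mxtrace1.
  rewrite -mulr_suml; congr (_ * _).
  rewrite -[LHS]/(\tr (E i j + E j i)) mxtraceD !trace_delta eq_sym.
  by rewrite mulr_natl.
by rewrite -[d%:R * _ *+ d]mulr_natr -[_ * (_ - 1) *+ d]mulr_natr; field.
Qed.

Lemma diamond_lower : (
    ((2 * d%:R ^+ 4 - d%:R ^+ 2 - 2 * d%:R + 4) / (3 * d%:R ^+ 2))%:E
    <= diamond_norm P)%E.
Proof.
have [[_ TP] _] := Pexact.
pose XF := d%:R ^- 3 *: (swap_left *m swap_right ^t*).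
pose XO := d%:R ^- 2 *: (omega_col *m omega_col ^t*).
have half (x : C) : (x + x) / 2 = x by field.
have dX0 n : 0 < d%:R ^+ n :> C by rewrite exprn_gt0.
have XF1 : trnorm XF <= 1.
  apply: le_trans (trnormZ_le _ _) _; rewrite gtr0_norm ?invr_gt0 //.
  rewrite ler_pdivrMl // mulr1; apply: le_trans (trnorm_mul_le _ _) _.
  by rewrite sqn_swap_left sqn_swap_right half.
have XO1 : trnorm XO <= 1.
  apply: le_trans (trnormZ_le _ _) _; rewrite gtr0_norm ?invr_gt0 //.
  rewrite ler_pdivrMl // mulr1; apply: le_trans (trnorm_mul_le _ _) _.
  by rewrite sqn_omega_col half.
have WF : contractive swap_mx.
  by apply: unitary_contractive; rewrite swap_adj swap_swap.
have WO := unitary_contractive omega_reflection_unitary.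
set qF := \tr (swap_mx ^t* *m id_tens P XF).
set qO := \tr (omega_reflection ^t* *m id_tens P XO).
(* With weights 2 and 1 the swap sum and the Omega sum both carry the factor [2 / d^3], so only
   their total matters, and [exact_sum] determines it; the constant -1 comes from the identity in
   [omega_reflection]. *)
have qE : 2 * qF + qO = 3 * ((2 * d%:R ^+ 4 - d%:R ^+ 2 - 2 * d%:R + 4) /
    (3 * d%:R ^+ 2)).
  have qFE : qF = d%:R ^- 3 * \sum_i \sum_j \sum_k \sum_l
      P (E i j *t (E j i *t E l k)) k l.
    rewrite /qF mxtrace_swap -exchange_big4 exchange_big mulr_sumr.
    apply: eq_bigr => k _; rewrite mulr_sumr; apply: eq_bigr => l _ /=.
    rewrite ref_block_id_tens ref_blockZ ref_block_swap linearZ mxE.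
    congr (_ * _); rewrite linear_sum summxE; apply: eq_bigr => i _.
    by rewrite linear_sum summxE.
  have qOE : qO = d%:R ^- 2 * ((2 / d%:R) * (\sum_i \sum_j \sum_k \sum_l
      P (E i j *t (E i j *t E k l)) k l) - d%:R ^+ 2).
    rewrite /qO adjmxB adjmxZ adj_scalar conjC1 mulmxBl mul1mx -scalemxAl.
    rewrite raddfB /= mxtraceZ mxtrace_omega mulrBr; congr (_ - _).
      rewrite rmorphM fmorphV !rmorph_nat mulrCA; congr (_ * _).
      rewrite -exchange_big4 mulr_sumr.
      apply: eq_bigr => k _; rewrite mulr_sumr; apply: eq_bigr => l _ /=.
      rewrite ref_block_id_tens ref_blockZ ref_block_omega linearZ mxE.
      congr (_ * _); rewrite linear_sum summxE; apply: eq_bigr => i _.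
      by rewrite linear_sum summxE.
    (* The identity in the reflection sees only the trace of the output, which trace preservation
       reduces to the trace [d^2] of the unnormalised input. *)
    rewrite mxtrace_blocks; under eq_bigr => k _.
      rewrite ref_block_id_tens TP ref_blockZ mxtraceZ ref_block_omega raddf_sum.
      over.
    rewrite -mulr_sumr; congr (_ * _).
    rewrite (eq_bigr (fun=> d%:R)) => [|k _].
      by rewrite sumr_const card_ord -[LHS]mulr_natr expr2.
    rewrite (eq_bigr (fun=> 1)) => [|i _] /=.
      by rewrite sumr_const card_ord.
    transitivity (\sum_j (i == j)%:R * (i == j)%:R : C); last first.
      by rewrite sum_pickr eqxx.
    rewrite raddf_sum; apply: eq_bigr => j _ /=.
    by rewrite !mxtrace_tens !trace_delta eqxx mulr1.
  have AB : \sum_i \sum_j \sum_k \sum_l P (E i j *t (E j i *t E l k)) k l +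
      \sum_i \sum_j \sum_k \sum_l P (E i j *t (E i j *t E k l)) k l =
      d%:R ^+ 4 * (d%:R - 1) + (d%:R ^+ 2 + d%:R) * (d%:R - 1) * d%:R + 2 * d%:R.
    rewrite -big_split /=.
    transitivity (\sum_(i < d) (d%:R * (d%:R ^+ 2 * (d%:R - 1)) +
        (d%:R + 1) * (d%:R - 1) * d%:R + 2) : C); last first.
      by rewrite sumr_const card_ord -[LHS]mulr_natr; ring.
    apply: eq_bigr => i _; rewrite -big_split /=.
    transitivity (\sum_(j < d) (d%:R ^+ 2 * (d%:R - 1) + (d%:R - 1) * d%:R +
        (i == j)%:R * ((d%:R - 1) * d%:R + 2)) : C); last first.
      by rewrite big_split /= sumr_const card_ord sum_pickr -[_ *+ d]mulr_natr; ring.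
    apply: eq_bigr => j _; transitivity (\sum_k \sum_l P (E i j *t S i j k l) k l).
      rewrite -big_split; apply: eq_bigr => k _ /=.
      rewrite -big_split; apply: eq_bigr => l _ /=.
      by rewrite /S tensmxDr linearD mxE addrC.
    by rewrite exact_sum; ring.
  transitivity (d%:R ^- 3 * 2 * (d%:R ^+ 4 * (d%:R - 1) +
    (d%:R ^+ 2 + d%:R) * (d%:R - 1) * d%:R + 2 * d%:R) - 1 : C); last by field.
  by rewrite -AB qFE qOE; field.
set lam := (X in (X%:E <= _)%E).
have lamE : 2 * qF + qO = (3 * lam)%:C.
  rewrite qE /lam rmorphM fmorph_div /= !(rmorphM, rmorphD, rmorphN, rmorphXn) /=.
  by rewrite !rmorph_nat.
apply: (weighted_bound lamE) => [a|b].
  exact: diamond_norm_ge XF1 WF.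
exact: diamond_norm_ge XO1 WO.
Qed.

End Lower.
End Bipartite.

(** * Upper bound *)

Section Upper.
Variables (R : realType) (d : nat).
Local Notation C := R[i].

(* A (x) (B (x) C) regrouped as (A (x) B) (x) C. *)
Definition asc (q : 'I_(d * d)) (k : 'I_d) : 'I_(d * (d * d)) :=
  mxtens_index ((mxtens_unindex q).1, mxtens_index ((mxtens_unindex q).2, k)).

Definition asc_pair (p : 'I_(d * (d * d))) : 'I_(d * d) :=
  mxtens_index ((mxtens_unindex p).1, (mxtens_unindex (mxtens_unindex p).2).1).

Definition asc_last (p : 'I_(d * (d * d))) : 'I_d :=
  (mxtens_unindex (mxtens_unindex p).2).2.

Lemma asc_pairK q k : asc_pair (asc q k) = q.
Proof.
rewrite /asc_pair /asc mxtens_indexK; cbn [fst snd].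
by rewrite mxtens_indexK -surjective_pairing mxtens_unindexK.
Qed.

Lemma asc_lastK q k : asc_last (asc q k) = k.
Proof.
by rewrite /asc_last /asc mxtens_indexK; cbn [fst snd]; rewrite mxtens_indexK.
Qed.

Lemma ascK p : asc (asc_pair p) (asc_last p) = p.
Proof.
case: (mxtens_indexP p) => i p'; case: (mxtens_indexP p') => j k.
rewrite /asc /asc_pair /asc_last mxtens_indexK; cbn [fst snd].
by rewrite !mxtens_indexK.
Qed.

Lemma big_asc (V : nmodType) (f : 'I_(d * (d * d)) -> V) :
  \sum_p f p = \sum_q \sum_k f (asc q k).
Proof.
rewrite !big_mxtens; apply: eq_bigr => i _; rewrite big_mxtens.
by apply: eq_bigr => j _; apply: eq_bigr => k _; rewrite /asc mxtens_indexK.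
Qed.

(** The operator [<m| M] on AB tensored with the identity on C. *)
Definition contract_op (M : 'M[C]_(d * d)) (m : 'I_(d * d)) :
    'M[C]_(d, d * (d * d)) :=
  \matrix_(k, p) (M m (asc_pair p) * (k == asc_last p)%:R).

(** The partial trace over AB of [(M (x) 1) X]. *)
Definition contract (M : 'M[C]_(d * d)) (X : 'M[C]_(d * (d * d))) : 'M[C]_d :=
  \matrix_(k, l) \sum_p \sum_q M q p * X (asc p k) (asc q l).

Lemma contract_op_mul M m n (X : 'M[C]_(d * (d * d), n)) k l :
  (contract_op M m *m X) k l = \sum_q M m q * X (asc q k) l.
Proof.
rewrite mxE big_asc; apply: eq_bigr => q _.
rewrite -[RHS](sum_pickr k (fun r => M m q * X (asc q r) l)).
by apply: eq_bigr => r _; rewrite !mxE asc_pairK asc_lastK; ring.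
Qed.

Lemma contract_kraus M X : M ^t* *m M = M ->
  \sum_m contract_op M m *m X *m (contract_op M m) ^t* = contract M X.
Proof.
move=> MM; apply/matrixP => k l; rewrite summxE.
transitivity (\sum_m \sum_p \sum_q
    (M m q)^* * M m p * X (asc p k) (asc q l) : C); last first.
  rewrite exchange_big mxE; apply: eq_bigr => p _.
  rewrite exchange_big; apply: eq_bigr => q _.
  by rewrite -mulr_suml -[in RHS]MM mxE; congr (_ * _);
    apply: eq_bigr => m _; rewrite !mxE.
apply: eq_bigr => m _; rewrite -mulmxA contract_op_mul; apply: eq_bigr => p _.
rewrite mxE big_asc mulr_sumr; apply: eq_bigr => q _.
rewrite -[RHS](sum_pickr l (fun r => (M m q)^* * M m p * X (asc p k) (asc q r))).
rewrite mulr_sumr; apply: eq_bigr => r _.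
by rewrite !mxE asc_pairK asc_lastK rmorphM rmorph_nat; ring.
Qed.

Lemma contract_op_gram M : M ^t* *m M = M ->
  \sum_m (contract_op M m) ^t* *m contract_op M m =
  \matrix_(p, q) (M (asc_pair p) (asc_pair q) * (asc_last p == asc_last q)%:R).
Proof.
move=> MM; apply/matrixP => p q; rewrite summxE [RHS]mxE -[in RHS]MM mxE mulr_suml.
apply: eq_bigr => m _; rewrite mxE.
rewrite -[RHS](sum_pickl (asc_last p) (fun k => (M ^t*) (asc_pair p) m *
  M m (asc_pair q) * (k == asc_last q)%:R)).
by apply: eq_bigr => k _; rewrite !mxE rmorphM rmorph_nat; ring.
Qed.

(** The Kraus normalisation is the transposed partial trace over the output of the Choi operator
    [N N^* = N]; the transpose is harmless on a scalar. *)
Lemma kraus_op_gram (N : 'M[C]_(d * d)) (w : C) : N *m N ^t* = N ->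
  (forall k l, \sum_a N (mxtens_index (k, a)) (mxtens_index (l, a)) =
     w * (k == l)%:R) ->
  \sum_n (kraus_op N n) ^t* *m kraus_op N n = w%:M.
Proof.
move=> NN Nw; apply/matrixP => k l; rewrite summxE mxE -mulr_natr eq_sym -Nw.
transitivity (\sum_n \sum_a N (mxtens_index (l, a)) n *
    (N (mxtens_index (k, a)) n)^*).
  apply: eq_bigr => n _; rewrite mxE; apply: eq_bigr => a _.
  by rewrite !mxE mulrC.
rewrite exchange_big; apply: eq_bigr => a _; rewrite -[in RHS]NN mxE.
by apply: eq_bigr => n _; rewrite !mxE.
Qed.

Lemma contractD M N X : contract (M + N) X = contract M X + contract N X.
Proof.
apply/matrixP => k l; rewrite !mxE -big_split; apply: eq_bigr => p _ /=.
by rewrite -big_split; apply: eq_bigr => q _; rewrite mxE mulrDl.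
Qed.

Lemma contractZ a M X : contract (a *: M) X = a *: contract M X.
Proof.
apply/matrixP => k l; rewrite !mxE mulr_sumr; apply: eq_bigr => p _ /=.
by rewrite mulr_sumr; apply: eq_bigr => q _; rewrite mxE mulrA.
Qed.

Lemma contract_linear M : linear (contract M).
Proof.
move=> a X Y; apply/matrixP => k l; rewrite !mxE mulr_sumr -big_split.
apply: eq_bigr => p _ /=; rewrite mulr_sumr -big_split; apply: eq_bigr => q _ /=.
by rewrite !mxE; ring.
Qed.

Lemma contract_tens M (X : 'M[C]_d) (J : 'M[C]_(d * d)) k l :
  contract M (X *t J) k l = \sum_i \sum_j \sum_i' \sum_j'
    M (mxtens_index (i', j')) (mxtens_index (i, j)) *
    (X i i' * ref_block J j j' k l).
Proof.
rewrite mxE big_mxtens; apply: eq_bigr => i _; apply: eq_bigr => j _.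
rewrite big_mxtens; apply: eq_bigr => i' _; apply: eq_bigr => j' _.
by rewrite /asc !mxtens_indexK tensmxE mxE.
Qed.

(** Post-selected teleportation through the program. With [contract_swap] and [contract_one] this
    gives the action of every sector: apply the map, apply it to the transposed input, or discard
    the input. *)
Lemma contract_omega X J : contract (omega_mx R d) (X *t J) = of_choi J X.
Proof.
apply/matrixP => k l; rewrite contract_tens summxE; apply: eq_bigr => i _.
rewrite summxE.
transitivity (\sum_j (i == j)%:R * \sum_i' \sum_j' (i' == j')%:R *
   (X i i' * ref_block J j j' k l)).
  apply: eq_bigr => j _; rewrite mulr_sumr; apply: eq_bigr => i' _.
  rewrite mulr_sumr; apply: eq_bigr => j' _.
  by rewrite omega_mxE; ring.
by rewrite sum_pickr; apply: eq_bigr => j _; rewrite sum_pickr !mxE.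
Qed.

Lemma contract_swap X J : contract (swap_mx R d) (X *t J) = of_choi J X^T.
Proof.
apply/matrixP => k l; rewrite contract_tens summxE exchange_big.
apply: eq_bigr => j _; rewrite summxE; apply: eq_bigr => i _.
transitivity (\sum_i' (i' == j)%:R * \sum_j' (j' == i)%:R *
   (X i i' * ref_block J j j' k l)).
  apply: eq_bigr => i' _; rewrite mulr_sumr; apply: eq_bigr => j' _.
  by rewrite swap_mxE; ring.
by rewrite !sum_pickl !mxE.
Qed.

Lemma contract_one X J : contract 1%:M (X *t J) = \tr X *: of_choi J 1%:M.
Proof.
apply/matrixP => k l; rewrite contract_tens mxE mulr_suml.
apply: eq_bigr => i _; rewrite summxE mulr_sumr; apply: eq_bigr => j _.
transitivity (\sum_i' (i' == i)%:R * \sum_j' (j' == j)%:R *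
   (X i i' * ref_block J j j' k l)).
  apply: eq_bigr => i' _; rewrite mulr_sumr; apply: eq_bigr => j' _.
  by rewrite mxE (can_eq (@mxtens_indexK _ _)) xpair_eqE -mulnb natrM; ring.
rewrite !sum_pickl summxE -[X i i * _]mulr1 mulr_sumr.
transitivity (\sum_j' (j == j')%:R * (X i i * ref_block J j j' k l)).
  by rewrite sum_pickr mulr1.
by apply: eq_bigr => j' _; rewrite !mxE; ring.
Qed.

Lemma of_choi_omega L : of_choi (omega_mx R d) L = L.
Proof.
rewrite [RHS]matrix_sum_delta; apply: eq_bigr => k _; apply: eq_bigr => l _.
congr (_ *: _); apply/matrixP => a b; rewrite !mxE !mxtens_indexK /=.
by rewrite -natrM mulnb [k == a]eq_sym [l == b]eq_sym.
Qed.

Lemma of_choi_swap L : of_choi (swap_mx R d) L = L^T.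
Proof.
rewrite [RHS]matrix_sum_delta exchange_big.
apply: eq_bigr => k _; apply: eq_bigr => l _.
rewrite mxE; congr (_ *: _); apply/matrixP => a b; rewrite !mxE !mxtens_indexK /=.
by rewrite -natrM mulnb andbC [k == b]eq_sym.
Qed.

Lemma of_choi_one L : of_choi (1%:M : 'M[C]_(d * d)) L = (\tr L)%:M.
Proof.
apply/matrixP => a b; rewrite summxE [RHS]mxE /mxtrace -sumrMnl.
apply: eq_bigr => k _; rewrite summxE.
rewrite -[RHS](sum_pickr k (fun l => L k l *+ (a == b))).
apply: eq_bigr => l _; rewrite !mxE (can_eq (@mxtens_indexK _ _)) xpair_eqE.
by rewrite -mulnb natrM -mulr_natr; ring.
Qed.


(** Real Hermitian Choi operators are symmetric, and symmetry makes the map commute with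
    transposition. Thus the swap contraction yields the transpose of the desired output. *)
Lemma of_choi_trmx n (J : 'M[C]_(n * n)) X : J^T = J ->
  of_choi J X^T = (of_choi J X)^T.
Proof.
move=> JT; rewrite linear_sum /of_choi exchange_big; apply: eq_bigr => k _ /=.
rewrite linear_sum; apply: eq_bigr => l _; rewrite linearZ mxE /=; congr (_ *: _).
by apply/matrixP => i j; rewrite !mxE -[in LHS]JT mxE.
Qed.

(** * The three sectors and the optimal programming map *)

Hypothesis d_ge2 : (2 <= d)%N.
Let d_gt0 : (0 < d)%N. Proof. exact: leq_trans d_ge2. Qed.
Let d_neq0 : d%:R != 0 :> R. Proof. by rewrite pnatr_eq0 -lt0n. Qed.
Let dC_neq0 : d%:R != 0 :> C. Proof. by rewrite pnatr_eq0 -lt0n. Qed.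
Let dB1_neq0 : d%:R - 1 != 0 :> R.
Proof. by rewrite subr_eq0 pnatr_eq1 gtn_eqF. Qed.

(* [sector] lists the projectors onto the irreducible summands of O (x) O for
   real orthogonal O: the maximally entangled line, the traceless symmetric
   tensors and the antisymmetric tensors; [weight x] is their rank over [d]. *)
Definition omega_coef (x : 'I_3) : R := nth 0 [:: d%:R^-1; - d%:R^-1; 0] x.
Definition swap_coef (x : 'I_3) : R := nth 0 [:: 0; 2^-1; - 2^-1] x.
Definition one_coef (x : 'I_3) : R := nth 0 [:: 0; 2^-1; 2^-1] x.

Definition sector (x : 'I_3) : 'M[C]_(d * d) :=
  (omega_coef x)%:C *: omega_mx R d + (swap_coef x)%:C *: swap_mx R d +
  (one_coef x)%:C *: 1%:M.

Definition weight (x : 'I_3) : R := nth 0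
  [:: d%:R^-1; (d%:R - 1) * (d%:R + 2) / (2 * d%:R); (d%:R - 1) / 2] x.

Lemma adjmx_realZ n (a : R) (A : 'M[C]_n) : A ^t* = A ->
  (a%:C *: A) ^t* = a%:C *: A.
Proof. by move=> AA; rewrite adjmxZ AA; congr (_ *: _); apply: conjC_real. Qed.

Lemma sector_adj x : (sector x) ^t* = sector x.
Proof.
rewrite adjmxD [X in X + _]adjmxD.
congr (_ + _ + _); apply: adjmx_realZ; first exact: omega_adj.
  exact: swap_adj.
by rewrite adj_scalar; congr (_%:M); apply: conjC1.
Qed.

Lemma sector_idem x : sector x *m sector x = sector x.
Proof.
have castM (a b : R) : (a * b)%:C = a%:C * b%:C :> C by rewrite rmorphM.
have castD (a b : R) : (a + b)%:C = a%:C + b%:C :> C by rewrite rmorphD.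
have castd : (d%:R : R)%:C = d%:R :> C by rewrite rmorph_nat.
(* Idempotence written in the coordinates Omega, F and 1, by their multiplication table. *)
have [E1 E2 E3] : [/\
  omega_coef x * omega_coef x * d%:R + (omega_coef x * swap_coef x +
    omega_coef x * swap_coef x) + (omega_coef x * one_coef x +
    omega_coef x * one_coef x) = omega_coef x,
  swap_coef x * one_coef x + swap_coef x * one_coef x = swap_coef x &
  swap_coef x * swap_coef x + one_coef x * one_coef x = one_coef x].
  by case: x => [[|[|[|//]]] ?]; rewrite /omega_coef /swap_coef /one_coef /=;
    split; field.
have square (a b c : C) :
    (a *: omega_mx R d + b *: swap_mx R d + c *: 1%:M) *m
    (a *: omega_mx R d + b *: swap_mx R d + c *: 1%:M) =
    (a * a * d%:R + (a * b + a * b) + (a * c + a * c)) *: omega_mx R d +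
    (b * c + b * c) *: swap_mx R d + (b * b + c * c) *: 1%:M.
  rewrite !mulmxDl !mulmxDr -!scalemxAl -!scalemxAr !mulmx1 !mul1mx.
  rewrite omega_omega swap_swap swap_omega omega_swap.
  move: (omega_mx R d) (swap_mx R d) (1%:M : 'M[C]_(d * d)) => O S I.
  by apply/matrixP => i j; rewrite !mxE; ring.
rewrite /sector square -castd -!castM -!castD E1 E2 E3.
by [].
Qed.

(** Omega and F both have the identity as partial trace, and the identity has [d] times it; [weight]
    collects these contributions. *)
Lemma sector_partial_trace x k l :
  \sum_a sector x (mxtens_index (k, a)) (mxtens_index (l, a)) =
  (weight x)%:C * (k == l)%:R.
Proof.
have omega_pt : \sum_a omega_mx R d (mxtens_index (k, a)) (mxtens_index (l, a)) =
    (k == l)%:R.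
  under eq_bigr do rewrite omega_mxE.
  by rewrite -[RHS](sum_pickr k (fun a => (a == l)%:R)); apply: eq_bigr => a _;
    rewrite [l == a]eq_sym.
have swap_pt : \sum_a swap_mx R d (mxtens_index (k, a)) (mxtens_index (l, a)) =
    (k == l)%:R.
  under eq_bigr do rewrite swap_mxE.
  exact: sum_pickr.
have one_pt : \sum_a (1%:M : 'M[C]_(d * d)) (mxtens_index (k, a)) (mxtens_index (l, a)) =
    d%:R * (k == l)%:R.
  rewrite (eq_bigr (fun=> (k == l)%:R)) => [|a _]; last first.
    by rewrite mxE (can_eq (@mxtens_indexK _ _)) xpair_eqE eqxx andbT.
  by rewrite sumr_const card_ord -[LHS]mulr_natl.
transitivity ((omega_coef x)%:C * (k == l)%:R + (swap_coef x)%:C * (k == l)%:R +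
   (one_coef x)%:C * (d%:R * (k == l)%:R) : C).
  rewrite -[in X in _ + X]one_pt -[in X in _ + X + _]swap_pt.
  rewrite -[in X in X + _ + _]omega_pt !mulr_sumr -!big_split.
  by apply: eq_bigr => a _; rewrite /= !mxE.
rewrite mulrA -!mulrDl; congr (_ * _).
rewrite -(rmorph_nat (real_complex R) d) -rmorphM -!rmorphD; congr (_%:C).
case: x => [[|[|[|//]]] ?]; rewrite /omega_coef /swap_coef /one_coef /weight /=; by field.
Qed.

(* An optimal vertex of the linear program of minimising the largest
   [\sum_y `|coef x y| * weight y] under [coef_weight] and [program_sums]; at
   this vertex the three sums are equal. *)
Definition coef (x y : 'I_3) : R := nth 0 (nth [::]
  [:: [:: (d%:R ^+ 4 + d%:R ^+ 2 - d%:R + 2) / (3 * d%:R); 0;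
          - (2 * (d%:R ^+ 3 + d%:R ^+ 2 - d%:R - 2) / (3 * d%:R ^+ 2))];
      [:: (d%:R ^+ 2 - d%:R + 2) / d%:R;
          2 * (d%:R ^+ 3 - 2 * d%:R ^+ 2 + 2 * d%:R - 2) / (3 * d%:R * (d%:R - 1));
          - (2 * (d%:R ^+ 3 + d%:R ^+ 2 - d%:R - 2) / (3 * d%:R ^+ 2))];
      [:: - ((d%:R - 2) * (d%:R + 1) / d%:R);
          - (2 * (d%:R ^+ 3 - 2 * d%:R ^+ 2 - d%:R + 4) / (3 * d%:R * (d%:R - 1)));
          2 * (d%:R ^+ 4 + d%:R ^+ 2 - d%:R + 2) / (3 * d%:R ^+ 2 * (d%:R - 1))]] x) y.

Definition optimum : R :=
  (2 * d%:R ^+ 4 - d%:R ^+ 2 - 2 * d%:R + 4) / (3 * d%:R ^+ 2).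

(** Through [program_gram] this is trace preservation of [program_map]. *)
Lemma coef_weight x : \sum_y coef x y * weight y = 1.
Proof.
rewrite !big_ord_recl big_ord0 /coef /weight.
by case: x => [[|[|[|//]]] ?] /=; field; rewrite ?d_neq0 ?dB1_neq0.
Qed.

Lemma norm_coef_weight x : \sum_y `|coef x y| * weight y = optimum.
Proof.
(* In the variable [e = d - 2] every polynomial below has nonnegative coefficients, so [lra]
   concludes with the powers of [e] as atoms. This fixes the sign of each entry of [coef] for all
   [d >= 2]. *)
pose e : R := d%:R - 2.
have e_ge0 : 0 <= e by rewrite subr_ge0 ler_nat.
have dE : d%:R = e + 2 :> R by rewrite subrK.
have d0 : 0 <= d%:R :> R by rewrite ler0n.
have d1 : 0 <= d%:R - 1 :> R by rewrite dE; lra.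
have d30 : 0 <= 3 * d%:R :> R by rewrite mulr_ge0.
have d31 : 0 <= 3 * d%:R * (d%:R - 1) :> R by rewrite mulr_ge0.
have d32 : 0 <= 3 * d%:R ^+ 2 :> R by rewrite mulr_ge0 ?exprn_ge0.
have e2 : 0 <= e ^+ 2 by rewrite exprn_ge0.
have e3 : 0 <= e ^+ 3 by rewrite exprn_ge0.
have e4 : 0 <= e ^+ 4 by rewrite exprn_ge0.
have p1 : 0 <= d%:R ^+ 4 + d%:R ^+ 2 - d%:R + 2 :> R by rewrite dE; lra.
have p2 : 0 <= 2 * (d%:R ^+ 3 + d%:R ^+ 2 - d%:R - 2) :> R by rewrite dE; lra.
have p3 : 0 <= d%:R ^+ 2 - d%:R + 2 :> R by rewrite dE; lra.
have p4 : 0 <= 2 * (d%:R ^+ 3 - 2 * d%:R ^+ 2 + 2 * d%:R - 2) :> R by rewrite dE; lra.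
have p5 : 0 <= (d%:R - 2) * (d%:R + 1) :> R by rewrite dE; lra.
have p6 : 0 <= 2 * (d%:R ^+ 3 - 2 * d%:R ^+ 2 - d%:R + 4) :> R by rewrite dE; lra.
have p7 : 0 <= 2 * (d%:R ^+ 4 + d%:R ^+ 2 - d%:R + 2) :> R by rewrite dE; lra.
have d321 : 0 <= 3 * d%:R ^+ 2 * (d%:R - 1) :> R by rewrite mulr_ge0.
rewrite !big_ord_recl big_ord0 /coef /weight /optimum.
case: x => [[|[|[|//]]] ?] /=; rewrite ?normrN ?normr0 !ger0_norm ?divr_ge0 //;
  by field; rewrite ?d_neq0 ?dB1_neq0.
Qed.


(** The ansatz as a composition: contracting AB with [sector x] leaves an operator on C, to which
    the map with Choi operator [sector y] is applied. Kraus operators are then products. *)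
Definition program_map (X : 'M[C]_(d * (d * d))) : 'M[C]_d :=
  \sum_x \sum_y (coef x y)%:C *: of_choi (sector y) (contract (sector x) X).

Lemma program_map_is_linear : linear program_map.
Proof.
move=> a X Y; rewrite /program_map scaler_sumr -big_split.
apply: eq_bigr => x _ /=; rewrite scaler_sumr -big_split; apply: eq_bigr => y _ /=.
by rewrite contract_linear linearP scalerDr !scalerA mulrC.
Qed.

HB.instance Definition _ := GRing.isLinear.Build C
  'M[C]_(d * (d * d)) 'M[C]_d *:%R program_map program_map_is_linear.

Let index := ('I_3 * 'I_3 * 'I_(d * d) * 'I_(d * d))%type.

Definition program_kraus (t : index) : 'M[C]_(d, d * (d * d)) :=
  kraus_op (sector t.1.1.2) t.2 *m contract_op (sector t.1.1.1) t.1.2.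

Lemma big_index (V : nmodType) (F : 'I_3 -> 'I_3 -> 'I_(d * d) -> 'I_(d * d) -> V) :
  \sum_(t : index) F t.1.1.1 t.1.1.2 t.1.2 t.2 =
  \sum_x \sum_y \sum_m \sum_n F x y m n.
Proof. by rewrite !pair_bigA. Qed.

Lemma program_mapE X : program_map X = \sum_(t : index)
  (coef t.1.1.1 t.1.1.2)%:C *: (program_kraus t *m X *m (program_kraus t) ^t*).
Proof.
rewrite (big_index (fun x y m n => (coef x y)%:C *:
  ((kraus_op (sector y) n *m contract_op (sector x) m) *m X *m
   (kraus_op (sector y) n *m contract_op (sector x) m) ^t*))).
apply: eq_bigr => x _; apply: eq_bigr => y _.
rewrite -contract_kraus ?sector_adj ?sector_idem // (linear_sum (of_choi (sector y))) /= scaler_sumr.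
apply: eq_bigr => m _; have := @of_choi_gram R d d (d * d) (sector y).
rewrite sector_adj sector_idem => ->; rewrite scaler_sumr.
by apply: eq_bigr => n _; rewrite adjmxM !mulmxA.
Qed.

Lemma sum_sector : \sum_x sector x = 1%:M.
Proof.
have cast (f : 'I_3 -> R) (A : 'M[C]_(d * d)) :
    \sum_x (f x)%:C *: A = (\sum_x f x)%:C *: A.
  by rewrite rmorph_sum scaler_suml.
have [E1 E2 E3] : [/\ \sum_x omega_coef x = 0, \sum_x swap_coef x = 0 &
    \sum_x one_coef x = 1].
  rewrite !big_ord_recl !big_ord0 /omega_coef /swap_coef /one_coef /=.
  by split; field.
by rewrite !big_split /= !cast E1 E2 E3 !scale0r !add0r scale1r.
Qed.

(** The sum over [n] gives [weight y] times the identity, the sum over [y] gives [l] in every row,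
    and the sectors resolve the identity on AB. Taking [f = coef] yields trace preservation, and its
    absolute value the diamond norm bound. *)
Lemma program_gram (f : 'I_3 -> 'I_3 -> R) (l : R) :
  (forall x, \sum_y f x y * weight y = l) ->
  \sum_(t : index) (f t.1.1.1 t.1.1.2)%:C *:
     ((program_kraus t) ^t* *m program_kraus t) = l%:C *: 1%:M.
Proof.
move=> fl; rewrite (big_index (fun x y m n => (f x y)%:C *:
  ((kraus_op (sector y) n *m contract_op (sector x) m) ^t* *m
   (kraus_op (sector y) n *m contract_op (sector x) m)))).
transitivity (l%:C *: \sum_x \sum_m
    (contract_op (sector x) m) ^t* *m contract_op (sector x) m).
  rewrite scaler_sumr; apply: eq_bigr => x _.
  rewrite -(fl x) rmorph_sum scaler_suml; apply: eq_bigr => y _ /=.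
  rewrite scaler_sumr; apply: eq_bigr => m _.
  rewrite -scaler_sumr rmorphM -scalerA; congr (_ *: _).
  have <- : (contract_op (sector x) m) ^t* *m ((weight y)%:C)%:M *m
      contract_op (sector x) m = (weight y)%:C *:
      ((contract_op (sector x) m) ^t* *m contract_op (sector x) m).
    by rewrite mul_mx_scalar -scalemxAl.
  rewrite -(kraus_op_gram _ (sector_partial_trace y)) ?sector_adj ?sector_idem //.
  rewrite mulmx_sumr mulmx_suml; apply: eq_bigr => n _.
  by rewrite adjmxM !mulmxA.
congr (_ *: _); under eq_bigr do
  rewrite contract_op_gram ?sector_adj ?sector_idem //.
apply/matrixP => p q; rewrite summxE; under eq_bigr do rewrite mxE.
have -> : 1%:M p q = ((asc_pair p == asc_pair q) && (asc_last p == asc_last q))%:R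
    :> C.
  rewrite mxE; congr (nat_of_bool _)%:R; apply/eqP/andP => [->|[/eqP pq /eqP lq]].
    by [].
  by rewrite -[p]ascK pq lq ascK.
by rewrite -mulr_suml -summxE sum_sector mxE -natrM mulnb.
Qed.

(** The coefficients of [A], [A^T], [D] and 1 in [program_map_tens]. The value [d] compensates the
    factor [1 / d] in the program state; the other three must cancel. *)
Lemma program_sums : [/\
  \sum_x \sum_y coef x y * (omega_coef y * omega_coef x +
     swap_coef y * swap_coef x) = d%:R,
  \sum_x \sum_y coef x y * (omega_coef y * swap_coef x +
     swap_coef y * omega_coef x) = 0,
  \sum_x \sum_y coef x y * (one_coef x * (omega_coef y + swap_coef y)) = 0 &
  \sum_x \sum_y coef x y * (one_coef y *
     (omega_coef x + swap_coef x + one_coef x * d%:R)) = 0].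
Proof.
rewrite !big_ord_recl !big_ord0 /coef /omega_coef /swap_coef /one_coef /=.
by split; field; rewrite ?d_neq0 ?dB1_neq0.
Qed.

Lemma scale_comb (a b c a' b' c' n : C) (A B D I : 'M[C]_d) :
  a' *: (a *: A + b *: B + c *: D) + b' *: (a *: B + b *: A + c *: D) +
    c' *: ((a + b + c * n) *: I) =
  (a' * a + b' * b) *: A + (a' * b + b' * a) *: B + (c * (a' + b')) *: D +
    (c' * (a + b + c * n)) *: I.
Proof. by apply/matrixP => i j; rewrite !mxE; ring. Qed.

Lemma program_map_tens (X : 'M[C]_d) (J : 'M[C]_(d * d)) :
  J^T = J -> \tr X = 1 -> \tr (of_choi J X) = 1 ->
  \tr (of_choi J 1%:M) = d%:R ->
  program_map (X *t J) = d%:R *: of_choi J X.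
Proof.
move=> JT tX tA tD; set A := of_choi J X; set D := of_choi J 1%:M.
have DT : D^T = D by rewrite /D -of_choi_trmx // trmx1.
have termE x y : of_choi (sector y) (contract (sector x) (X *t J)) =
    (omega_coef y * omega_coef x + swap_coef y * swap_coef x)%:C *: A +
    (omega_coef y * swap_coef x + swap_coef y * omega_coef x)%:C *: A^T +
    (one_coef x * (omega_coef y + swap_coef y))%:C *: D +
    (one_coef y * (omega_coef x + swap_coef x + one_coef x * d%:R))%:C *: 1%:M.
  have LE : contract (sector x) (X *t J) = (omega_coef x)%:C *: A +
      (swap_coef x)%:C *: A^T + (one_coef x)%:C *: D.
    rewrite !contractD !contractZ contract_omega contract_swap contract_one.
    by rewrite tX scale1r of_choi_trmx.
  have LT : (contract (sector x) (X *t J))^T = (omega_coef x)%:C *: A^T +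
      (swap_coef x)%:C *: A + (one_coef x)%:C *: D.
    rewrite LE; apply/matrixP => i j; rewrite !mxE; congr (_ + _ * _).
    by rewrite -[in RHS]DT mxE.
  have Ltr : \tr (contract (sector x) (X *t J)) =
      (omega_coef x)%:C + (swap_coef x)%:C + (one_coef x)%:C * d%:R.
    by rewrite LE !mxtraceD !mxtraceZ mxtrace_tr tA tD !mulr1.
  have castM (a b : R) : (a * b)%:C = a%:C * b%:C :> C by rewrite rmorphM.
  have castD (a b : R) : (a + b)%:C = a%:C + b%:C :> C by rewrite rmorphD.
  have castd : (d%:R : R)%:C = d%:R :> C by rewrite rmorph_nat.
  rewrite {1}/sector !of_choiD !of_choiZ of_choi_omega of_choi_swap of_choi_one.
  rewrite LT Ltr LE.
  rewrite -[(_ + _ + _)%:M]scalemx1.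
  apply: etrans (scale_comb _ _ _ _ _ _ _ _ _ _ _) _; rewrite -castd.
  by rewrite -!castM -!castD -!castM.
have [E1 E2 E3 E4] := program_sums.
have cast (F : 'I_3 -> 'I_3 -> R) (M : 'M[C]_d) s :
    \sum_x \sum_y coef x y * F x y = s ->
    \sum_x \sum_y (coef x y)%:C *: ((F x y)%:C *: M) = s%:C *: M.
  move=> <-; rewrite rmorph_sum scaler_suml; apply: eq_bigr => x _ /=.
  rewrite rmorph_sum scaler_suml; apply: eq_bigr => y _ /=.
  by rewrite scalerA rmorphM.
(* The vanishing terms are inserted so that each of the four identities can be expanded back into a
   double sum. *)
have -> : d%:R *: A = (d%:R : R)%:C *: A + (0 : R)%:C *: A^T + (0 : R)%:C *: D +
    (0 : R)%:C *: 1%:M by rewrite rmorph0 rmorph_nat !scale0r !addr0.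
rewrite -(cast _ A _ E1) -(cast _ A^T _ E2) -(cast _ D _ E3) -(cast _ 1%:M _ E4).
rewrite -!big_split; apply: eq_bigr => x _; rewrite -!big_split.
by apply: eq_bigr => y _; rewrite termE !scalerDr.
Qed.

Lemma omega_psd : psdmx (omega_mx R d).
Proof.
have -> : omega_mx R d = \col_p ((mxtens_unindex p).1 == (mxtens_unindex p).2)%:R *m
    (\col_p ((mxtens_unindex p).1 == (mxtens_unindex p).2)%:R) ^t*.
  by apply/matrixP => p q; rewrite !mxE big_ord1 !mxE rmorph_nat.
exact: psd_gram.
Qed.

(** The Choi operator is the image of the positive operator Omega under [id (x) E]. *)
Lemma choi_herm (E : {linear 'M[C]_d -> 'M[C]_d}) :
  completely_positive E -> (choi E) ^t* = choi E.
Proof.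
move=> /(_ d (omega_mx R d) omega_psd) [/hermsymmxP choiE _].
suff -> : choi E = id_tens E (omega_mx R d) by [].
apply: ref_blockP => i j; rewrite ref_block_choi ref_block_id_tens; congr (E _).
by rewrite -of_choi_delta of_choi_omega.
Qed.

Lemma program_map_exact : exact_programming (real_channels R d) program_map.
Proof.
split.
  split; first exact: kraus_hp program_mapE.
  apply: (kraus_tp program_mapE); rewrite (program_gram coef_weight).
  by rewrite rmorph1 scale1r.
move=> rho E [_ trho] [[Ecp Etp] Ereal] /=.
(* This is where reality of the Choi operator enters the upper bound. *)
have JT : (choi E)^T = choi E.
  have := choi_herm Ecp; rewrite -map_trmx (realmxC Ereal).
  by [].
rewrite /program_state tensmxZr linearZ /= program_map_tens //.
- by rewrite scalerA mulVf // scale1r choiK.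
- by rewrite choiK Etp.
- by rewrite choiK Etp mxtrace1.
Qed.

Lemma program_map_diamond : (diamond_norm program_map <= optimum%:E)%E.
Proof.
apply: (kraus_diamond_le program_mapE); last exact: program_gram norm_coef_weight.
(* Nonnegativity of [optimum] is read off its expression as a weighted l1 norm. *)
rewrite -(norm_coef_weight 0) sumr_ge0 // => x _; rewrite mulr_ge0 //.
rewrite /weight; have d1 : 0 <= d%:R - 1 :> R by rewrite subr_ge0 ler1n.
have d2 : 0 <= d%:R + 2 :> R by rewrite addr_ge0.
by case: x => [[|[|[|//]]] ?] /=; rewrite ?divr_ge0 ?mulr_ge0 ?invr_ge0.
Qed.

End Upper.

Local Close Scope complex_scope.
Local Close Scope sesquilinear_scope.

Theorem theoremS8 (R : realType) (d : nat) (hd : (2 <= d)%N) :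
  overhead1 (real_channels R d) =
    ((2 * d%:R ^+ 4 - d%:R ^+ 2 - 2 * d%:R + 4) / (3 * d%:R ^+ 2) : R)%:E
  /\ programming_costs (real_channels R d) (overhead1 (real_channels R d)).
Proof.
have d_gt0 : (0 < d)%N by apply: leq_trans hd.
have lower c : programming_costs (real_channels R d) c -> ((optimum R d)%:E <= c)%E.
  by move=> [P Pexact <-]; apply: diamond_lower.
have cost : programming_costs (real_channels R d) (optimum R d)%:E.
  exists (@program_map R d); first exact: program_map_exact.
  (* The Kraus estimate is only an upper bound; the lower bound applied to [program_map] itself
     makes it an equality, so the infimum is attained. *)
  apply/eqP; rewrite eq_le program_map_diamond //=.
  by apply: lower; exists (@program_map R d) => //; apply: program_map_exact.
suff -> : overhead1 (real_channels R d) = (optimum R d)%:E by [].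
apply/eqP; rewrite eq_le ereal_inf_lbound //=.
exact: le_ereal_inf_tmp.
Qed.
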